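(* Let $\mathcal{C}$ be a $\bar G$-graded $\bar G$-acted $\mathcal{O}$-algebra, let $A$ and $A'$ be two $\bar G$-graded crossed products over $\mathcal{C}$ with identity components $B$ and $B'$, and let $\Delta^{\mathcal{C}}=\Delta(A\otimes_{\mathcal{C}}A'^{\mathrm{op}})$. The functors $$(A\otimes_{\mathcal{C}}A'^{\mathrm{op}})\otimes_{\Delta^{\mathcal{C}}}-,\qquad A\otimes_B-,\qquad -\otimes_{B'}A'\ :\ \Delta^{\mathcal{C}}\text{-}\mathrm{Mod}\to A\text{-}\mathrm{Gr}/\mathcal{C}\text{-}A'$$ are naturally isomorphic equivalences of categories, and their inverse is taking the $1$-component $(-)_1$.
   Context: $\mathcal{O}$ is a complete discrete valuation ring and $\bar G=G/N$, where $G$ is a finite group and $N$ a normal subgroup. A $\bar G$-graded $\mathcal{O}$-algebra $A=\bigoplus_{\bar g\in\bar G}A_{\bar g}$ is a crossed product if each $A_{\bar g}$ contains an invertible element $u_{\bar g}$ of $A$. Let $A$, $A'$ be $\bar G$-graded crossed products with identity components $B=A_1$, $B'=A'_1$ and invertible homogeneous elements $u_{\bar g}\in A_{\bar g}$, $u'_{\bar g}\in A'_{\bar g}$. A $\bar G$-graded $\bar G$-acted $\mathcal{O}$-algebra is a $\bar G$-graded $\mathcal{O}$-algebra $\mathcal{C}=\bigoplus_{\bar g}\mathcal{C}_{\bar g}$ with a left action of $\bar G$ (by $\mathcal{O}$-algebra automorphisms), $c\mapsto{}^{\bar g}c$, such that ${}^{\bar g}\mathcal{C}_{\bar h}\subseteq\mathcal{C}_{\bar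 g\bar h\bar g^{-1}}$. Example: the centralizer $C_A(B)$ with components $C_A(B)_{\bar h}=C_A(B)\cap A_{\bar h}$ and action ${}^{\bar g}c=u_{\bar g}cu_{\bar g}^{-1}$ (independent of the choice of $u_{\bar g}$). $A$ is over $\mathcal{C}$ if it is equipped with a homomorphism of $\bar G$-graded $\bar G$-acted algebras $\zeta:\mathcal{C}\to C_A(B)$ (grade-preserving and $\bar G$-equivariant). Similarly $A'$ is over $\mathcal{C}$ via $\zeta':\mathcal{C}\to C_{A'}(B')$. $\mathcal{C}$ acts on modules over $A$, $A'$ through $\zeta,\zeta'$. A $\bar G$-graded $(A,A')$-bimodule over $\mathcal{C}$ is an $(A,A')$-bimodule $\tilde M=\bigoplus_{\bar g}\tilde M_{\bar g}$ with $A_{\bar g}\tilde M_{\bar x}A'_{\bar h}\subseteq\tilde M_{\bar g\bar x\bar h}$ and $\tilde m_{\bar g}\cdot c={}^{\bar g}c\cdot\tilde m_{\bar g}$ for all $c\in\mathcal{C}$, $\tilde m_{\bar g}\in\tilde M_{\bar g}$, $\bar g\in\bar G$. These form the category $A\text{-}\mathrm{Gr}/\mathcal{C}\text{-}A'$, whose morphisms are the grade-preserving $(A,A')$-bimodule homomorphisms. The tensor product $A\otimes_{\mathcal{C}}A'^{\mathrm{op}}$ is formed with $ac\otimes a'=a\otimes ca'$, where $ac=a\zeta(c)$ and $ca'=\zeta'(c)a'$ (product in $A'$). $\Delta^{\mathcal{C}}=\Delta(A\otimes_{\mathcal{C}}A'^{\mathrm{op}})$ is the $\mathcal{O}$-submodule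 $\sum_{\bar g\in\bar G}A_{\bar g}\otimes_{\mathcal{C}}A'_{\bar g^{-1}}$ spanned by the elements $a\otimes a'$ with $a\in A_{\bar g}$, $a'\in A'_{\bar g^{-1}}$; it is an $\mathcal{O}$-algebra with $(a\otimes a')(d\otimes d')=ad\otimes d'a'$ (products on the right in $A$ and $A'$). $A\otimes_{\mathcal{C}}A'^{\mathrm{op}}$ is a right $\Delta^{\mathcal{C}}$-module by the same formula, and a $\bar G$-graded $(A,A')$-bimodule via $x(a\otimes a')y=xa\otimes a'y$, with $\bar x$-component spanned by $a\otimes a'$, $a\in A_{\bar g}$, $a'\in A'_{\bar h}$, $\bar g\bar h=\bar x$. For a $\Delta^{\mathcal{C}}$-module $M$ (which is a $(B,B')$-bimodule via $bmb'=(b\otimes b')m$), the three functors give graded bimodules as follows. (i) $(A\otimes_{\mathcal{C}}A'^{\mathrm{op}})\otimes_{\Delta^{\mathcal{C}}}M$ has structure and grading coming from the left factor. (ii) $A\otimes_BM$ has the obvious left $A$-structure, right $A'$-structure $(a\otimes m)a'_{\bar h}=au_{\bar h}\otimes(u_{\bar h}^{-1}\otimes a'_{\bar h})m$ for $a'_{\bar h}\in A'_{\bar h}$, and $\bar x$-component $A_{\bar x}\otimes_BM$. (iii) $M\otimes_{B'}A'$ has the obvious right $A'$-structure, left $A$-structure $a_{\bar g}(m\otimes a')=(a_{\bar g}\otimes u'^{-1}_{\bar g})m\otimes u'_{\bar g}a'$ for $a_{\bar g}\in A_{\bar g}$, and $\bar x$-component $M\otimes_{B'}A'_{\bar x}$.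 The $1$-component $\tilde M_1$ of a graded bimodule over $\mathcal{C}$ is a $\Delta^{\mathcal{C}}$-module via $(a\otimes a')m=ama'$. *)

(* Defs.v *)
From HB Require Import structures.
From mathcomp Require Import all_boot all_algebra all_fingroup generic_quotient.
From mathcomp Require Import boolp classical_sets.

Set Implicit Arguments.
Unset Strict Implicit.
Unset Printing Implicit Defensive.

Import GRing.Theory.

Local Open Scope classical_set_scope.
Local Open Scope quotient_scope.
Local Open Scope ring_scope.

Section AdditiveMaps.
Variables (V W : zmodType).

Definition addmap (f : V -> W) := {morph f : x y / x + y}.

Variables (f : V -> W) (fD : addmap f).

Lemma addmap0 : f 0 = 0.
Proof. by apply: (addrI (f 0)); rewrite -fD !addr0. Qed.

Lemma addmapN x : f (- x) = - f x.
Proof. by apply: (addrI (f x)); rewrite -fD !subrr addmap0. Qed.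

Lemma addmapB x y : f (x - y) = f x - f y.
Proof. by rewrite fD addmapN. Qed.

Lemma addmap_sum I r (P : pred I) (F : I -> V) :
  f (\sum_(i <- r | P i) F i) = \sum_(i <- r | P i) f (F i).
Proof. exact: (big_morph f fD addmap0). Qed.
End AdditiveMaps.

(** Tensor product of a right module [M] (action [ra]) and a left module [N]
    (action [la]) over [R], presented by generators and relations.  As
    [- (m (x) n) = (- m) (x) n], formal sums without signs suffice.  Only the
    two actions enter, so [R] need not be given as a ring. *)
Section Tensor.
Variables (M N : zmodType) (R : Type) (ra : M -> R -> M) (la : R -> N -> N).

Inductive tensor_rel : seq (M * N) -> seq (M * N) -> Prop :=
| TR_refl s : tensor_rel s s
| TR_sym s t : tensor_rel s t -> tensor_rel t s
| TR_trans s t u : tensor_rel s t -> tensor_rel t u -> tensor_rel s u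
| TR_cat s s' t t' :
    tensor_rel s s' -> tensor_rel t t' -> tensor_rel (s ++ t) (s' ++ t')
| TR_catC s t : tensor_rel (s ++ t) (t ++ s)
| TR_0l n : tensor_rel [:: (0, n)] [::]
| TR_Dl m m' n : tensor_rel [:: (m + m', n)] [:: (m, n); (m', n)]
| TR_Dr m n n' : tensor_rel [:: (m, n + n')] [:: (m, n); (m, n')]
| TR_bal m r n : tensor_rel [:: (ra m r, n)] [:: (m, la r n)].

Definition tensor_relb (s t : seq (M * N)) : bool := `[< tensor_rel s t >].

Lemma tensor_relb_equiv : equiv_class_of tensor_relb.
Proof.
split; first by move=> s; apply/asboolP; exact: TR_refl.
  by move=> s t; apply/asboolP/asboolP; exact: TR_sym.
move=> s t u /asboolP st /asboolP tu; apply/asboolP; exact: TR_trans st tu.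
Qed.

Canonical tensor_relb_rel := EquivRelPack tensor_relb_equiv.

Definition tensor := {eq_quot tensor_relb}.
HB.instance Definition _ := Choice.on tensor.
HB.instance Definition _ := EqQuotient.on tensor.

Definition tensor_class (s : seq (M * N)) : tensor := \pi_tensor s.

Lemma tensor_classP s t :
  tensor_class s = tensor_class t <-> tensor_rel s t.
Proof.
split; first by move/eqquotP => /asboolP.
by move=> st; apply/eqquotP/asboolP.
Qed.

Lemma tensor_reprP s : tensor_rel (repr (tensor_class s)) s.
Proof. by apply/tensor_classP; rewrite /tensor_class reprK. Qed.

Definition tensor_add (x y : tensor) : tensor :=
  tensor_class (repr x ++ repr y).
Definition tensor_oppl (s : seq (M * N)) := [seq (- p.1, p.2) | p <- s].
Definition tensor_opp (x : tensor) : tensor :=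
  tensor_class (tensor_oppl (repr x)).

Lemma tensor_class_cat s t :
  tensor_class (s ++ t) = tensor_add (tensor_class s) (tensor_class t).
Proof.
apply/tensor_classP/TR_sym/TR_cat; exact: tensor_reprP.
Qed.

Lemma tensor_class_ind (P : tensor -> Prop) :
  (forall s, P (tensor_class s)) -> forall x, P x.
Proof. by move=> H x; rewrite -[x]reprK; exact: H. Qed.

Lemma tensor_addC : commutative tensor_add.
Proof.
elim/tensor_class_ind => s; elim/tensor_class_ind => t.
by rewrite -!tensor_class_cat; apply/tensor_classP/TR_catC.
Qed.

Lemma tensor_addA : associative tensor_add.
Proof.
elim/tensor_class_ind => s; elim/tensor_class_ind => t.
by elim/tensor_class_ind => u; rewrite -!tensor_class_cat catA.
Qed.

Lemma tensor_add0 : left_id (tensor_class [::]) tensor_add.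
Proof. by elim/tensor_class_ind => s; rewrite -tensor_class_cat. Qed.

Lemma tensor_rel_subr s : tensor_rel (tensor_oppl s ++ s) [::].
Proof.
elim: s => [|[m n] s IHs] /=; first exact: TR_refl.
have cons_cat x (u : seq (M * N)) : x :: u = [:: x] ++ u by [].
apply: (@TR_trans _ ([:: (- m, n); (m, n)] ++ (tensor_oppl s ++ s))).
  rewrite [X in tensor_rel X _]cons_cat [X in tensor_rel _ X]/=.
  rewrite [X in tensor_rel _ X]cons_cat; apply: TR_cat; first exact: TR_refl.
  apply: TR_trans (TR_catC _ _) _ => /=.
  by rewrite cons_cat [X in tensor_rel _ X]cons_cat; apply: TR_cat;
    [exact: TR_refl|exact: TR_catC].
rewrite -[X in tensor_rel _ X]cats0; apply: TR_cat => //.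
apply: TR_trans (TR_sym (TR_Dl _ _ _)) _; rewrite addNr; exact: TR_0l.
Qed.

Lemma tensor_addN : left_inverse (tensor_class [::]) tensor_opp tensor_add.
Proof.
move=> x; rewrite -{2}[x]reprK -/(tensor_class _) -tensor_class_cat.
exact/tensor_classP/tensor_rel_subr.
Qed.

HB.instance Definition _ := GRing.isZmodule.Build tensor
  tensor_addA tensor_addC tensor_add0 tensor_addN.

Definition tens (m : M) (n : N) : tensor := tensor_class [:: (m, n)].

Lemma tensor_classE s : tensor_class s = \sum_(p <- s) tens p.1 p.2.
Proof.
elim: s => [|[m n] s IHs]; first by rewrite big_nil.
by rewrite big_cons -IHs; exact: (tensor_class_cat [:: (m, n)] s).
Qed.

Lemma tensDl m m' n : tens (m + m') n = tens m n + tens m' n.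
Proof.
have /tensor_classP H := TR_Dl m m' n.
by rewrite {1}/tens H tensor_classE !big_cons big_nil addr0.
Qed.

Lemma tensDr m n n' : tens m (n + n') = tens m n + tens m n'.
Proof.
have /tensor_classP H := TR_Dr m n n'.
by rewrite {1}/tens H tensor_classE !big_cons big_nil addr0.
Qed.

Lemma tens_bal m r n : tens (ra m r) n = tens m (la r n).
Proof. by have /tensor_classP := TR_bal m r n. Qed.

Lemma tensor_ind (P : tensor -> Prop) :
  P 0 -> (forall x y, P x -> P y -> P (x + y)) ->
  (forall m n, P (tens m n)) -> forall x, P x.
Proof.
move=> P0 PD Pt; elim/tensor_class_ind => s; rewrite tensor_classE.
by elim/big_ind: _ => // -[m n] _; exact: Pt.
Qed.

(** [tensor_lift f] is total in [f], but only meaningful when [f] is biadditive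
    and balanced: it is then the unique additive map with
    [m (x) n |-> f m n], by [tensor_liftE], [tensor_liftD], [tensor_ext]. *)
Section Lift.
Variable Z : zmodType.

Definition balanced (f : M -> N -> Z) :=
  [/\ forall n, addmap (f^~ n), forall m, addmap (f m)
    & forall m r n, f (ra m r) n = f m (la r n)].

Definition tensor_lift (f : M -> N -> Z) (t : tensor) : Z :=
  \sum_(p <- repr t) f p.1 p.2.

Variables (f : M -> N -> Z) (fP : balanced f).

Lemma lift_rel s t : tensor_rel s t ->
  \sum_(p <- s) f p.1 p.2 = \sum_(p <- t) f p.1 p.2.
Proof.
case: fP => fl fr fb; elim=> //.
- by move=> ? ? ? _ -> _ ->.
- by move=> ? ? ? ? _ e1 _ e2; rewrite !big_cat e1 e2.
- by move=> ? ?; rewrite !big_cat /= addrC.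
- by move=> n; rewrite big_seq1 big_nil /= (addmap0 (fl n)).
- by move=> m m' n; rewrite !big_cons !big_nil /= !addr0 (fl n).
- by move=> m n n'; rewrite !big_cons !big_nil /= !addr0 (fr m).
- by move=> m r n; rewrite !big_seq1 /= fb.
Qed.

Lemma lift_class s : tensor_lift f (tensor_class s) = \sum_(p <- s) f p.1 p.2.
Proof. exact/lift_rel/tensor_reprP. Qed.

Lemma tensor_liftE m n : tensor_lift f (tens m n) = f m n.
Proof. by rewrite lift_class big_seq1. Qed.

Lemma tensor_liftD : addmap (tensor_lift f).
Proof.
elim/tensor_class_ind => s; elim/tensor_class_ind => t.
have -> : tensor_class s + tensor_class t = tensor_class (s ++ t).
  by rewrite tensor_class_cat.
by rewrite !lift_class big_cat.
Qed.
End Lift.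

Lemma tensor_ext (Z : zmodType) (f g : tensor -> Z) :
  addmap f -> addmap g -> (forall m n, f (tens m n) = g (tens m n)) -> f =1 g.
Proof.
move=> fD gD fg; elim/tensor_ind => //; first by rewrite !addmap0.
by move=> x y ex ey; rewrite fD gD ex ey.
Qed.

End Tensor.

Definition addspan (V : zmodType) (S : set V) : set V :=
  [set v | exists2 s : seq V, {in s, forall x, S x} & v = \sum_(x <- s) x].

Section Subgroups.
Variable V : zmodType.

Definition is_subgroup (S : set V) :=
  S 0 /\ forall x y, S x -> S y -> S (x - y).

Lemma subgroup0 S : is_subgroup S -> S 0. Proof. by case. Qed.

Lemma subgroupB S x y : is_subgroup S -> S x -> S y -> S (x - y).
Proof. by case=> _; exact. Qed.

Lemma subgroupD S x y : is_subgroup S -> S x -> S y -> S (x + y).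
Proof.
by case=> S0 SB Sx Sy; rewrite -[y]opprK; apply: (SB) => //; rewrite -sub0r; apply: SB.
Qed.

Lemma subgroup_sum S I (r : seq I) (P : pred I) (F : I -> V) : is_subgroup S ->
  (forall i, P i -> S (F i)) -> S (\sum_(i <- r | P i) F i).
Proof.
move=> SS SF; elim/big_ind: _ => //; first exact: subgroup0.
by move=> x y; exact: subgroupD.
Qed.

Lemma addspan_sub (S : set V) v : S v -> addspan S v.
Proof. by move=> Sv; exists [:: v]; [move=> x; rewrite inE => /eqP ->|rewrite big_seq1]. Qed.

Lemma addspan_ind (S P : V -> Prop) : P 0 ->
  (forall x y, P x -> P y -> P (x + y)) -> (forall v, S v -> P v) ->
  forall v, addspan S v -> P v.
Proof.
move=> P0 PD SP _ [s sS ->]; rewrite big_seq.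
by elim/big_ind: _ => // x /sS /SP.
Qed.

Lemma addspan_subgroup (S : set V) : (forall v, S v -> S (- v)) -> is_subgroup (addspan S).
Proof.
move=> SN; split; first by exists [::]; rewrite ?big_nil.
move=> _ _ [s sS ->] [t tS ->]; exists (s ++ [seq - x | x <- t]).
  move=> x; rewrite mem_cat => /orP[/sS //|/mapP[y /tS yt ->]]; exact: SN.
by rewrite big_cat /= big_map sumrN.
Qed.
End Subgroups.

Section Gradings.
Variables (I : finType) (V : zmodType).
Implicit Types (P : I -> set V) (v : V).

Definition decomposition P v : set {ffun I -> V} :=
  [set f | (forall i, P i (f i)) /\ v = \sum_i f i].

(** [V] is the internal direct sum of the subgroups [P i]. *)
Definition is_grading P :=
  (forall i, is_subgroup (P i)) /\ (forall v, exists! f, decomposition P v f).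

(** The homogeneous component of degree [i] of [v]. *)
Definition hcomp P i v : V := xget [ffun=> 0] (decomposition P v) i.

Variables (P : I -> set V) (gP : is_grading P).

Lemma hcomp_dec v : decomposition P v (xget [ffun=> 0] (decomposition P v)).
Proof. by have [f [fP _]] := gP.2 v; apply: xgetPex; exists f. Qed.

Lemma hcompP i v : P i (hcomp P i v).
Proof. by have [] := hcomp_dec v. Qed.

Lemma hcomp_sum v : \sum_i hcomp P i v = v.
Proof. by rewrite [RHS](hcomp_dec v).2. Qed.

Lemma hcomp_uniq f v : (forall i, P i (f i)) -> v = \sum_i f i ->
  forall i, hcomp P i v = f i.
Proof.
move=> Pf vf i; have [g [_ gU]] := gP.2 v.
have df : decomposition P v [ffun i => f i].
  by split=> [j|]; rewrite ?ffunE // vf; apply: eq_bigr => j _; rewrite ffunE.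
by rewrite /hcomp -(gU _ (hcomp_dec v)) (gU _ df) ffunE.
Qed.

Lemma hcompD i : addmap (hcomp P i).
Proof.
move=> v w; apply: (@hcomp_uniq (fun j => hcomp P j v + hcomp P j w)).
  by move=> j; apply: (subgroupD (gP.1 j)); exact: hcompP.
by rewrite big_split !hcomp_sum.
Qed.

Lemma hcomp_in i j v : P i v -> hcomp P j v = if j == i then v else 0.
Proof.
move=> Pv; apply: (@hcomp_uniq (fun j => if j == i then v else 0)).
  by move=> k; case: eqP => [->//|_]; exact: subgroup0 (gP.1 k).
by rewrite -big_mkcond big_pred1_eq.
Qed.

Lemma hcomp_id i v : P i v -> hcomp P i v = v.
Proof. by move/(hcomp_in i) => ->; rewrite eqxx. Qed.

Lemma hom_ind (Q : V -> Prop) : Q 0 -> (forall x y, Q x -> Q y -> Q (x + y)) ->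
  (forall i v, P i v -> Q v) -> forall v, Q v.
Proof.
move=> Q0 QD QP v; rewrite -(hcomp_sum v).
by elim/big_ind: _ => // i _; exact: QP (hcompP i v).
Qed.

Lemma hom_ext (W : zmodType) (f g : V -> W) : addmap f -> addmap g ->
  (forall i v, P i v -> f v = g v) -> f =1 g.
Proof.
move=> fD gD fg v; rewrite -(hcomp_sum v) (addmap_sum fD) (addmap_sum gD).
by apply: eq_bigr => i _; apply: fg (hcompP _ _).
Qed.
End Gradings.

Lemma grading_of_proj (I : finType) (V : zmodType) (P : I -> set V)
    (p : I -> V -> V) : (forall i, is_subgroup (P i)) ->
  (forall i, addmap (p i)) -> (forall i v, P i (p i v)) ->
  (forall v, \sum_i p i v = v) ->
  (forall i j v, P i v -> p j v = if j == i then v else 0) ->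
  is_grading P.
Proof.
move=> PS pD pP psum pE; split=> // v; exists [ffun i => p i v]; split.
  by split=> [i|]; rewrite ?ffunE // -{1}[v]psum; apply: eq_bigr => i _; rewrite ffunE.
move=> f [fP ->]; apply/ffunP => i; rewrite ffunE (addmap_sum (pD i)).
by rewrite (bigD1 i) //= (pE i) // eqxx big1 ?addr0 // => j ji; rewrite (pE j) // eq_sym (negPf ji).
Qed.

(** An [O]-algebra is a possibly zero ring with a ring homomorphism from [O]
    to its center ([algType] excludes the zero ring, which may occur as [C] or
    as the diagonal algebra). *)
Record o_algebra (O : comPzRingType) := OAlgebra {
  oa_sort :> pzRingType;
  oa_scalar : {rmorphism O -> oa_sort};
  oa_scalarC : forall k a, oa_scalar k * a = a * oa_scalar k }.

Definition is_alg_hom (O : comPzRingType) (A A' : o_algebra O)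
  (f : {rmorphism A -> A'}) := forall k, f (oa_scalar A k) = oa_scalar A' k.

Section Structures.
Variables (O : comPzRingType) (Gb : finGroupType).

Record graded_algebra := GradedAlgebra {
  ga_sort :> o_algebra O;
  ga_comp : Gb -> set ga_sort;
  ga_grading : is_grading ga_comp;
  ga_compZ : forall g k a, ga_comp g a -> ga_comp g (oa_scalar ga_sort k * a);
  ga_compM : forall g h a b,
    ga_comp g a -> ga_comp h b -> ga_comp (g * h)%g (a * b) }.

Record graded_acted_algebra := GradedActedAlgebra {
  gaa_sort :> graded_algebra;
  gaa_act : Gb -> {rmorphism gaa_sort -> gaa_sort};
  gaa_act_alg : forall g, is_alg_hom (gaa_act g);
  gaa_act1 : forall c, gaa_act 1%g c = c;
  gaa_actM : forall g h c, gaa_act (g * h)%g c = gaa_act g (gaa_act h c);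
  gaa_act_comp : forall g h c,
    ga_comp h c -> ga_comp (g * h * g^-1)%g (gaa_act g c) }.

(** A crossed product, with the chosen units [u_g] and their inverses. *)
Record crossed_product := CrossedProduct {
  cp_sort :> graded_algebra;
  cp_u : Gb -> cp_sort;
  cp_uV : Gb -> cp_sort;
  cp_u_comp : forall g, ga_comp g (cp_u g);
  cp_uuV : forall g, cp_u g * cp_uV g = 1;
  cp_uVu : forall g, cp_uV g * cp_u g = 1 }.

(** The centralizer [C_A(B)] of the identity component [B = A_1]. *)
Definition centralizer1 (A : graded_algebra) : set A :=
  [set a | forall b, ga_comp 1%g b -> a * b = b * a].
Arguments centralizer1 : clear implicits.

(** [A] over [C]: [co_zeta] is a homomorphism of graded acted algebras from [C]
    to [C_A(B)], on which [g] acts by conjugation by [u_g]. *)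
Record crossed_product_over (C : graded_acted_algebra) := CrossedProductOver {
  co_sort :> crossed_product;
  co_zeta : {rmorphism C -> co_sort};
  co_zeta_alg : is_alg_hom co_zeta;
  co_zeta_cent : forall c, centralizer1 co_sort (co_zeta c);
  co_zeta_comp : forall g c, ga_comp g c -> ga_comp g (co_zeta c);
  co_zeta_act : forall g c,
    co_zeta (gaa_act C g c) = cp_u co_sort g * co_zeta c * cp_uV co_sort g }.

Section GradedAlgebraTheory.
Variable A : graded_algebra.
Implicit Types (g h : Gb) (a b : A).

Let gA : is_grading (@ga_comp A) := @ga_grading A.

Lemma ga_comp1 : ga_comp 1%g (1 : A).
Proof.
have e1 a : hcomp (@ga_comp A) 1%g 1 * a = a.
  apply: (hom_ext gA (f := fun a => hcomp (@ga_comp A) 1%g 1 * a)) a.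
  - exact: mulrDr.
  - by [].
  move=> h a ha; have /(hcomp_id gA) := ha.
  rewrite -{1}[a]mul1r -{1}(hcomp_sum gA 1) mulr_suml (addmap_sum (hcompD gA h)).
  rewrite (bigD1 1%g) //= (hcomp_in gA (i := h)); last first.
    by rewrite -[X in ga_comp X _]mul1g; apply: ga_compM => //; exact: hcompP.
  rewrite eqxx big1 ?addr0 // => g g1; rewrite (hcomp_in gA (i := (g * h)%g)).
    by case: eqP => // /esym /eqP; rewrite -[X in _ == X]mul1g (inj_eq (mulIg h)) (negPf g1).
  by apply: ga_compM => //; exact: hcompP.
by have := hcompP gA 1%g 1; rewrite -[hcomp _ _ _]mulr1 e1.
Qed.
End GradedAlgebraTheory.

Section CrossedTheory.
Variables (C : graded_acted_algebra) (A : crossed_product_over C).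
Implicit Types (g h : Gb) (a b : A).

Lemma cp_uV_comp g : ga_comp g^-1%g (cp_uV A g).
Proof.
have gA := @ga_grading A.
suff e h : h != g^-1%g -> hcomp (@ga_comp A) h (cp_uV A g) = 0.
  rewrite -(hcomp_sum gA (cp_uV A g)) (bigD1 g^-1%g) //= big1 ?addr0 //.
  exact: hcompP.
move=> hg; have u0 : cp_u A g * hcomp (@ga_comp A) h (cp_uV A g) = 0.
  have := hcomp_in gA (g * h)%g (ga_comp1 A).
  rewrite -(cp_uuV A g) -[X in _ * X](hcomp_sum gA) mulr_sumr.
  rewrite (addmap_sum (hcompD gA _)) (bigD1 h) //= hcomp_id //; last first.
    by apply: ga_compM; [exact: cp_u_comp|exact: hcompP].
  rewrite big1 ?addr0 => [->|k kh]; last first.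
    rewrite (hcomp_in gA (i := (g * k)%g)); last first.
      by apply: ga_compM; [exact: cp_u_comp|exact: hcompP].
    by rewrite (inj_eq (mulgI g)) eq_sym (negPf kh).
  by rewrite -eq_invg_mul eq_sym (negPf hg).
by rewrite -[LHS]mul1r -(cp_uVu A g) -mulrA u0 mulr0.
Qed.

(* homogeneous elements move past the image of C at the cost of the action *)
Lemma co_zetaC g a c : ga_comp g a ->
  a * co_zeta A c = co_zeta A (gaa_act C g c) * a.
Proof.
move=> ga; rewrite co_zeta_act -!mulrA; set b := cp_uV A g * a.
have bB : ga_comp 1%g b.
  by rewrite -(mulVg g); apply: ga_compM => //; exact: cp_uV_comp.
have -> : a = cp_u A g * b by rewrite /b mulrA cp_uuV mul1r.
by move: b bB => b bB; rewrite -!mulrA -(co_zeta_cent c bB).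
Qed.

Lemma co_zetaCV g a c : ga_comp g a ->
  co_zeta A c * a = a * co_zeta A (gaa_act C g^-1%g c).
Proof. by move=> ga; rewrite (co_zetaC _ ga) -gaa_actM mulgV gaa_act1. Qed.
End CrossedTheory.
End Structures.

Lemma tensNl (M N : zmodType) (R : Type) (ra : M -> R -> M) (la : R -> N -> N)
  m n : tens ra la (- m) n = - tens ra la m n.
Proof. by apply: (addmapN (f := fun m => tens ra la m n)) => x y; exact: tensDl. Qed.

Lemma tensNr (M N : zmodType) (R : Type) (ra : M -> R -> M) (la : R -> N -> N)
  m n : tens ra la m (- n) = - tens ra la m n.
Proof. by apply: (addmapN (f := tens ra la m)) => x y; exact: tensDr. Qed.

Lemma tens0l (M N : zmodType) (R : Type) (ra : M -> R -> M) (la : R -> N -> N)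
  n : tens ra la 0 n = 0.
Proof. by apply: (addmap0 (f := fun m => tens ra la m n)) => x y; exact: tensDl. Qed.

Lemma tens0r (M N : zmodType) (R : Type) (ra : M -> R -> M) (la : R -> N -> N)
  m : tens ra la m 0 = 0.
Proof. by apply: (addmap0 (f := tens ra la m)) => x y; exact: tensDr. Qed.

Section DiagonalAlgebra.
Variables (O : comPzRingType) (Gb : finGroupType).
Variable C : graded_acted_algebra O Gb.

Definition hc (A : graded_algebra O Gb) (g : Gb) (a : A) : A :=
  hcomp (@ga_comp O Gb A) g a.

Lemma hcP (A : graded_algebra O Gb) g (a : A) : ga_comp g (hc g a).
Proof. exact: hcompP (@ga_grading _ _ A) _ _. Qed.

Lemma hcD (A : graded_algebra O Gb) g : addmap (@hc A g).
Proof. exact: hcompD (@ga_grading _ _ A) _. Qed.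

Lemma hc_in (A : graded_algebra O Gb) g h (a : A) :
  ga_comp g a -> hc h a = if h == g then a else 0.
Proof. exact: hcomp_in (@ga_grading _ _ A) _ _ _. Qed.

Lemma hc_id (A : graded_algebra O Gb) g (a : A) : ga_comp g a -> hc g a = a.
Proof. by move/hc_in => ->; rewrite eqxx. Qed.

Lemma hc_sum (A : graded_algebra O Gb) (a : A) : \sum_g hc g a = a.
Proof. exact: hcomp_sum (@ga_grading _ _ A) _. Qed.

Lemma comp_sg (A : graded_algebra O Gb) g : is_subgroup (@ga_comp _ _ A g).
Proof. exact: (@ga_grading _ _ A).1. Qed.

Lemma compN (A : graded_algebra O Gb) g (a : A) : ga_comp g a -> ga_comp g (- a).
Proof.
have sg := comp_sg A g; move=> ag; rewrite -sub0r.
exact: subgroupB sg (subgroup0 sg) ag.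
Qed.

Variables A A' : crossed_product_over C.

(** [A (x)_C A'^op].  Balancedness over [O] is the case of scalars in [C]. *)
Definition tensC := tensor
  (fun (a : A) (c : C) => a * co_zeta A c)
  (fun (c : C) (a' : A') => co_zeta A' c * a').
HB.instance Definition _ := GRing.Zmodule.on tensC.

Definition tC (a : A) (a' : A') : tensC := tens _ _ a a'.

Lemma tCDl a b a' : tC (a + b) a' = tC a a' + tC b a'. Proof. exact: tensDl. Qed.
Lemma tCDr a a' b' : tC a (a' + b') = tC a a' + tC a b'. Proof. exact: tensDr. Qed.
Lemma tC0l a' : tC 0 a' = 0. Proof. exact: tens0l. Qed.
Lemma tC0r a : tC a 0 = 0. Proof. exact: tens0r. Qed.
Lemma tC_bal a c a' : tC (a * co_zeta A c) a' = tC a (co_zeta A' c * a').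
Proof. exact: tens_bal. Qed.

Lemma tensC_ind (P : tensC -> Prop) : P 0 ->
  (forall x y, P x -> P y -> P (x + y)) -> (forall a a', P (tC a a')) ->
  forall t, P t.
Proof. exact: tensor_ind. Qed.

Lemma tensC_ext (Z : zmodType) (f g : tensC -> Z) : addmap f -> addmap g ->
  (forall a a', f (tC a a') = g (tC a a')) -> f =1 g.
Proof. exact: tensor_ext. Qed.

Definition tC_lift (Z : zmodType) (f : A -> A' -> Z) (t : tensC) : Z := tensor_lift f t.

Definition tC_balanced (Z : zmodType) (f : A -> A' -> Z) :=
  [/\ forall a', addmap (f^~ a'), forall a, addmap (f a)
    & forall a c a', f (a * co_zeta A c) a' = f a (co_zeta A' c * a')].

Lemma tC_liftE Z f a a' : tC_balanced f -> tC_lift (Z := Z) f (tC a a') = f a a'.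
Proof. by move=> fP; exact: tensor_liftE fP _ _. Qed.

Lemma tC_liftD Z f : tC_balanced f -> addmap (tC_lift (Z := Z) f).
Proof. by move=> fP; exact: tensor_liftD fP. Qed.

(** [x (a (x) a') y = x a (x) a' y], the products taken in [A] and [A']. *)
Definition tC_lact (x : A) : tensC -> tensC := tC_lift (fun a a' => tC (x * a) a').
Definition tC_ract (t : tensC) (y : A') : tensC := tC_lift (fun a a' => tC a (a' * y)) t.

Lemma tC_lact_bal x : tC_balanced (fun a a' => tC (x * a) a').
Proof.
split=> [a' a b|a a' b'|a c a']; first by rewrite mulrDr tCDl.
  by rewrite tCDr.
by rewrite mulrA tC_bal.
Qed.

Lemma tC_ract_bal y : tC_balanced (fun a a' => tC a (a' * y)).
Proof.
split=> [a' a b|a a' b'|a c a']; first by rewrite tCDl.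
  by rewrite mulrDl tCDr.
by rewrite -mulrA tC_bal.
Qed.

Lemma tC_lactE x a a' : tC_lact x (tC a a') = tC (x * a) a'.
Proof. exact: tC_liftE (tC_lact_bal x). Qed.
Lemma tC_ractE y a a' : tC_ract (tC a a') y = tC a (a' * y).
Proof. exact: tC_liftE (tC_ract_bal y). Qed.
Lemma tC_lactD x : addmap (tC_lact x).
Proof. exact: tC_liftD (tC_lact_bal x). Qed.
Lemma tC_ractD y : addmap (tC_ract^~ y).
Proof. exact: tC_liftD (tC_ract_bal y). Qed.

Lemma tC_lactA x y t : tC_lact x (tC_lact y t) = tC_lact (x * y) t.
Proof.
elim/tensC_ind: t => [|t s et es|a a'].
- by rewrite !(addmap0 (tC_lactD _)).
- by rewrite !tC_lactD et es.
by rewrite !tC_lactE mulrA.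
Qed.

Lemma tC_lact1 t : tC_lact 1 t = t.
Proof.
by elim/tensC_ind: t => [|t s et es|a a'];
  rewrite ?(addmap0 (tC_lactD _)) ?tC_lactD ?tC_lactE ?mul1r ?et ?es.
Qed.

Lemma tC_lact_addl t x y : tC_lact (x + y) t = tC_lact x t + tC_lact y t.
Proof.
elim/tensC_ind: t => [|t s et es|a a'].
- by rewrite !(addmap0 (tC_lactD _)) addr0.
- by rewrite !tC_lactD et es addrACA.
by rewrite !tC_lactE mulrDl tCDl.
Qed.

HB.instance Definition _ := GRing.Zmodule_isLmodule.Build A tensC
  tC_lactA tC_lact1 tC_lactD tC_lact_addl.

Lemma tC_scaleE x a a' : x *: tC a a' = tC (x * a) a'.
Proof. exact: tC_lactE. Qed.

Definition tC_comp (x : Gb) : set tensC := addspan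
  [set t | exists g h a a',
    [/\ (g * h)%g = x, ga_comp g a, ga_comp h a' & t = tC a a']].

Definition tC_projf x (a : A) (a' : A') := \sum_g tC (hc g a) (hc (g^-1 * x)%g a').
Definition tC_proj x := tC_lift (tC_projf x).

Lemma tC_projf_hom x g h a a' : ga_comp g a -> ga_comp h a' ->
  tC_projf x a a' = if (g * h)%g == x then tC a a' else 0.
Proof.
move=> ag a'h; rewrite /tC_projf (bigD1 g) //= big1 ?addr0 => [|k kg]; last first.
  by rewrite (hc_in _ ag) (negPf kg) tC0l.
rewrite (hc_in _ ag) eqxx (hc_in _ a'h) eq_sym.
have -> : (h == g^-1 * x)%g = (g * h == x)%g by rewrite -(inj_eq (mulgI g)) mulKVg.
by case: ifP => // _; rewrite tC0r.
Qed.

Lemma tC_projf_bal x : tC_balanced (tC_projf x).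
Proof.
have Dl a' : addmap (tC_projf x ^~ a').
  by move=> a b; rewrite -big_split /=; apply: eq_bigr => g _; rewrite hcD tCDl.
have Dr a : addmap (tC_projf x a).
  by move=> a' b'; rewrite -big_split /=; apply: eq_bigr => g _; rewrite hcD tCDr.
split=> // a c a'.
apply: (hom_ext (@ga_grading _ _ A)
  (f := fun a => tC_projf x (a * co_zeta A c) a')
  (g := fun a => tC_projf x a (co_zeta A' c * a'))).
- by move=> b d; rewrite mulrDl Dl.
- by move=> b d; rewrite Dl.
move=> g {}a ag; apply: (hom_ext (@ga_grading _ _ C)
  (f := fun c => tC_projf x (a * co_zeta A c) a')
  (g := fun c => tC_projf x a (co_zeta A' c * a'))).
- by move=> b d; rewrite rmorphD mulrDr Dl.
- by move=> b d; rewrite rmorphD mulrDl Dr.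
move=> k {}c ck; apply: (hom_ext (@ga_grading _ _ A')
  (f := fun a' => tC_projf x (a * co_zeta A c) a')
  (g := fun a' => tC_projf x a (co_zeta A' c * a'))).
- by move=> b d; rewrite Dr.
- by move=> b d; rewrite mulrDr Dr.
move=> h {}a' a'h.
have azc : ga_comp (g * k)%g (a * co_zeta A c).
  by apply: ga_compM => //; exact: co_zeta_comp.
have zca : ga_comp (k * h)%g (co_zeta A' c * a').
  by apply: ga_compM => //; exact: co_zeta_comp.
by rewrite (tC_projf_hom _ azc a'h) (tC_projf_hom _ ag zca) mulgA tC_bal.
Qed.

Lemma tC_projD x : addmap (tC_proj x).
Proof. exact: tC_liftD (tC_projf_bal x). Qed.

Lemma tC_projE x a a' : tC_proj x (tC a a') = tC_projf x a a'.
Proof. exact: tC_liftE (tC_projf_bal x). Qed.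

Lemma tC_comp_sg x : is_subgroup (tC_comp x).
Proof.
apply: addspan_subgroup => _ [g [h [a [a' [gh ag a'h ->]]]]].
exists g, h, (- a), a'; split=> //; last by rewrite /tC tensNl.
exact: compN.
Qed.

Lemma tC_comp_tens g h a a' : ga_comp g a -> ga_comp h a' ->
  tC_comp (g * h)%g (tC a a').
Proof. by move=> ag a'h; apply: addspan_sub; exists g, h, a, a'. Qed.

Lemma tC_compP x t : tC_comp x (tC_proj x t).
Proof.
elim/tensC_ind: t => [|t s et es|a a'].
- by rewrite (addmap0 (tC_projD x)); exact: subgroup0 (tC_comp_sg x).
- by rewrite tC_projD; exact: subgroupD (tC_comp_sg x) et es.
rewrite tC_projE; apply: subgroup_sum (tC_comp_sg x) _ => g _.
by rewrite -[X in tC_comp X _](mulKVg g); apply: tC_comp_tens; exact: hcP.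
Qed.

Lemma tC_proj_in x y t : tC_comp x t -> tC_proj y t = if y == x then t else 0.
Proof.
move: t; apply: addspan_ind => [|t s et es|_ [g [h [a [a' [<- ag a'h ->]]]]]].
- by rewrite (addmap0 (tC_projD y)) if_same.
- by rewrite tC_projD et es; case: ifP; rewrite ?addr0.
by rewrite tC_projE (tC_projf_hom _ ag a'h) eq_sym.
Qed.

Lemma tC_grading : is_grading tC_comp.
Proof.
apply: (grading_of_proj (p := tC_proj)).
- exact: tC_comp_sg.
- exact: tC_projD.
- by move=> x t; exact: tC_compP.
- move=> t; apply: (tensC_ext (f := fun t => \sum_x tC_proj x t) (g := id)) => //.
    by move=> s r; rewrite -big_split; apply: eq_bigr => x _; exact: tC_projD.
  move=> a a'; under eq_bigr do rewrite tC_projE.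
  rewrite /tC_projf exchange_big /=.
  rewrite -[in RHS](hc_sum a) (addmap_sum (f := fun a => tC a a')); last first.
    by move=> b d; exact: tCDl.
  apply: eq_bigr => g _; rewrite -(addmap_sum (f := fun a' => tC (hc g a) a')); last first.
    by move=> b d; exact: tCDr.
  congr tC; rewrite -[RHS]hc_sum [RHS](reindex_inj (mulgI g^-1%g)) //.
- by move=> x y t; exact: tC_proj_in.
Qed.

(** The additive span is an [O]-submodule, as the components of [A] are. *)
Definition diag_set : set tensC := addspan
  [set t | exists g a a', [/\ ga_comp g a, ga_comp g^-1%g a' & t = tC a a']].

Lemma diag_sg : is_subgroup diag_set.
Proof.
apply: addspan_subgroup => _ [g [a [a' [ag a'g ->]]]].
exists g, (- a), a'; split=> //; last by rewrite /tC tensNl.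
exact: compN.
Qed.

Lemma diag_tens g a a' :
  ga_comp g a -> ga_comp g^-1%g a' -> diag_set (tC a a').
Proof. by move=> ag a'g; apply: addspan_sub; exists g, a, a'. Qed.

Definition diag_pred : {pred tensC} := fun t => `[< diag_set t >].

Lemma diag_zmod_closed : zmod_closed diag_pred.
Proof.
split; first by apply/asboolP; exact: subgroup0 diag_sg.
by move=> x y /asboolP xD /asboolP yD; apply/asboolP; exact: subgroupB diag_sg xD yD.
Qed.
HB.instance Definition _ := GRing.isZmodClosed.Build tensC diag_pred diag_zmod_closed.

Definition diag := {t : tensC | t \in diag_pred}.
HB.instance Definition _ := SubChoice.on diag.
HB.instance Definition _ := [SubChoice_isSubZmodule of diag by <:].

Lemma diagP (d : diag) : diag_set (val d).
Proof. by apply/asboolP; exact: valP d. Qed.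

Definition mk_diag t (tD : diag_set t) : diag := exist _ t (asboolT tD).

(** [(a (x) a') (d (x) d') = a d (x) d' a'], well defined when the right
    factor is in [diag_set]: see [tC_mulE].  It gives both the product of the
    diagonal algebra and its right action on [A (x)_C A'^op]. *)
Definition tC_mulf (a : A) (a' : A') (s : tensC) : tensC :=
  tC_lift (fun d d' => tC (a * d) (d' * a')) s.
Definition tC_mul (t s : tensC) : tensC := tC_lift (fun a a' => tC_mulf a a' s) t.

Lemma tC_mulfE a a' d d' : tC_mulf a a' (tC d d') = tC (a * d) (d' * a').
Proof.
apply: tC_liftE; split=> [b' b e|b b' e'|b c b'].
- by rewrite mulrDr tCDl.
- by rewrite mulrDl tCDr.
- by rewrite mulrA tC_bal mulrA.
Qed.

Lemma tC_mulfD a a' : addmap (tC_mulf a a').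
Proof.
apply: tC_liftD; split=> [b' b e|b b' e'|b c b'].
- by rewrite mulrDr tCDl.
- by rewrite mulrDl tCDr.
- by rewrite mulrA tC_bal mulrA.
Qed.

Lemma tC_mulf_bal s : diag_set s -> tC_balanced (fun a a' => tC_mulf a a' s).
Proof.
have Dl a' s' : addmap (fun a => tC_mulf a a' s').
  move=> a b; elim/tensC_ind: s' => [|x y ex ey|d d'].
  - by rewrite !(addmap0 (tC_mulfD _ _)) addr0.
  - by rewrite !tC_mulfD ex ey addrACA.
  - by rewrite !tC_mulfE mulrDl tCDl.
have Dr a s' : addmap (fun a' => tC_mulf a a' s').
  move=> a' b; elim/tensC_ind: s' => [|x y ex ey|d d'].
  - by rewrite !(addmap0 (tC_mulfD _ _)) addr0.
  - by rewrite !tC_mulfD ex ey addrACA.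
  - by rewrite !tC_mulfE mulrDr tCDr.
move=> sD; split=> // a c a'; move: s sD; apply: addspan_ind => [|s r es er|].
- by rewrite !(addmap0 (tC_mulfD _ _)).
- by rewrite !tC_mulfD es er.
move=> _ [g [d [d' [dg d'g ->]]]]; rewrite !tC_mulfE.
rewrite -mulrA (co_zetaCV _ dg) !mulrA tC_bal mulrA; congr (tC _ (_ * _)).
by rewrite (co_zetaC _ d'g).
Qed.

Lemma tC_mul_tens a a' s : diag_set s -> tC_mul (tC a a') s = tC_mulf a a' s.
Proof. by move=> sD; exact: tC_liftE (tC_mulf_bal sD). Qed.

Lemma tC_mulE g a a' d d' : ga_comp g d -> ga_comp g^-1%g d' ->
  tC_mul (tC a a') (tC d d') = tC (a * d) (d' * a').
Proof. by move=> dg d'g; rewrite tC_mul_tens ?tC_mulfE //; exact: diag_tens d'g. Qed.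

Lemma tC_mulDl s : diag_set s -> addmap (tC_mul^~ s).
Proof. by move=> sD; exact: tC_liftD (tC_mulf_bal sD). Qed.

Lemma tC_mulDr t : addmap (tC_mul t).
Proof.
by move=> x y; rewrite -big_split; apply: eq_bigr => p _; exact: tC_mulfD.
Qed.

Lemma diag_ind (P : tensC -> Prop) : P 0 ->
  (forall x y, diag_set x -> diag_set y -> P x -> P y -> P (x + y)) ->
  (forall g a a', ga_comp g a -> ga_comp g^-1%g a' -> P (tC a a')) ->
  forall t, diag_set t -> P t.
Proof.
move=> P0 PD Pt t tD; suff [] : diag_set t /\ P t by [].
move: t tD; apply: addspan_ind => [|x y [xD xP] [yD yP]|_ [g [a [a' [ag a'g ->]]]]].
- by split=> //; exact: subgroup0 diag_sg.
- by split; [exact: subgroupD diag_sg xD yD|exact: PD].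
- by split; [exact: diag_tens a'g|exact: Pt a'g].
Qed.

Lemma diag_mul t s : diag_set t -> diag_set s -> diag_set (tC_mul t s).
Proof.
move=> tD sD; elim/diag_ind: s / sD => [|x y _ _ ex ey|h d d' dh d'h].
- by rewrite (addmap0 (tC_mulDr t)); exact: subgroup0 diag_sg.
- by rewrite tC_mulDr; exact: subgroupD diag_sg ex ey.
have dD := diag_tens dh d'h.
elim/diag_ind: t / tD => [|x y _ _ ex ey|g a a' ag a'g].
- by rewrite (addmap0 (tC_mulDl dD)); exact: subgroup0 diag_sg.
- by rewrite tC_mulDl //; exact: subgroupD diag_sg ex ey.
rewrite (tC_mulE _ _ dh d'h); apply: (@diag_tens (g * h)%g); first exact: ga_compM.
by rewrite invMg; exact: ga_compM.
Qed.

Lemma tC_mulA t s r : diag_set s -> diag_set r ->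
  tC_mul (tC_mul t s) r = tC_mul t (tC_mul s r).
Proof.
move=> sD rD; elim/tensC_ind: t => [|x y ex ey|a a'].
- by rewrite ?(addmap0 (tC_mulDl _)) //; exact: diag_mul.
- by rewrite ?tC_mulDl ?ex ?ey //; exact: diag_mul.
elim/diag_ind: s / sD => [|x y xD yD ex ey|g d d' dg d'g].
- by rewrite (addmap0 (tC_mulDr _)) !(addmap0 (tC_mulDl rD)) (addmap0 (tC_mulDr _)).
- by rewrite tC_mulDr !tC_mulDl // ex ey -tC_mulDr.
elim/diag_ind: r / rD => [|x y xD yD ex ey|h e e' eh e'h].
- by rewrite !(addmap0 (tC_mulDr _)).
- by rewrite !tC_mulDr ex ey.
rewrite (tC_mulE _ _ dg d'g) !(tC_mulE _ _ eh e'h) (@tC_mulE (g * h)%g).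
- by rewrite !mulrA.
- exact: ga_compM.
- by rewrite invMg; exact: ga_compM.
Qed.

Lemma diag1 : diag_set (tC 1 1).
Proof. by apply: (@diag_tens 1%g); rewrite ?invg1; exact: ga_comp1. Qed.

Lemma tC_mulr1 t : tC_mul t (tC 1 1) = t.
Proof.
apply: (tensC_ext (f := tC_mul^~ (tC 1 1)) (g := id)) t => //.
  exact: tC_mulDl diag1.
by move=> a a'; rewrite tC_mul_tens ?tC_mulfE ?mulr1 ?mul1r //; exact: diag1.
Qed.

Lemma tC_mul1r t : diag_set t -> tC_mul (tC 1 1) t = t.
Proof.
move=> tD; elim/diag_ind: t / tD => [|x y _ _ ex ey|g a a' ag a'g].
- by rewrite (addmap0 (tC_mulDr _)).
- by rewrite tC_mulDr ex ey.
by rewrite (tC_mulE _ _ ag a'g) mul1r mulr1.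
Qed.

Definition diag_mulr (s t : diag) : diag := mk_diag (diag_mul (diagP s) (diagP t)).
Definition diag_one : diag := mk_diag diag1.

Lemma diag_mulrA : associative diag_mulr.
Proof. by move=> x y z; apply: val_inj; rewrite /= tC_mulA //; exact: diagP. Qed.
Lemma diag_mul1r : left_id diag_one diag_mulr.
Proof. by move=> x; apply: val_inj; rewrite /= tC_mul1r //; exact: diagP. Qed.
Lemma diag_mulr1 : right_id diag_one diag_mulr.
Proof. by move=> x; apply: val_inj; rewrite /= tC_mulr1. Qed.
Lemma diag_mulrDl : left_distributive diag_mulr +%R.
Proof. by move=> x y z; apply: val_inj; rewrite /= tC_mulDl //; exact: diagP. Qed.
Lemma diag_mulrDr : right_distributive diag_mulr +%R.
Proof. by move=> x y z; apply: val_inj; rewrite /= tC_mulDr. Qed.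

HB.instance Definition _ := GRing.Zmodule_isPzRing.Build diag
  diag_mulrA diag_mul1r diag_mulr1 diag_mulrDl diag_mulrDr.

Lemma val_diagM (x y : diag) : val (x * y) = tC_mul (val x) (val y).
Proof. by []. Qed.

(** The element [a_g (x) a'_{g^-1}] of the diagonal algebra, with [a_g] and
    [a'_{g^-1}] the homogeneous components: biadditive in all [a], [a']. *)
Definition dt (g : Gb) (a : A) (a' : A') : diag :=
  mk_diag (diag_tens (hcP g a) (hcP g^-1%g a')).

Lemma dtDl g a b a' : dt g (a + b) a' = dt g a a' + dt g b a'.
Proof. by apply: val_inj; rewrite /= hcD tCDl. Qed.
Lemma dtDr g a a' b' : dt g a (a' + b') = dt g a a' + dt g a b'.
Proof. by apply: val_inj; rewrite /= hcD tCDr. Qed.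

Lemma val_dt g a a' :
  ga_comp g a -> ga_comp g^-1%g a' -> val (dt g a a') = tC a a'.
Proof. by move=> ag a'g; rewrite /= !hc_id. Qed.

Lemma dtM g h a a' d d' :
  ga_comp g a -> ga_comp g^-1%g a' -> ga_comp h d -> ga_comp h^-1%g d' ->
  dt g a a' * dt h d d' = dt (g * h)%g (a * d) (d' * a').
Proof.
move=> ag a'g dh d'h; apply: val_inj.
rewrite val_diagM !val_dt //; first exact: tC_mulE d'h.
  exact: ga_compM.
by rewrite invMg; exact: ga_compM.
Qed.

Lemma dt1 : dt 1%g 1 1 = 1.
Proof. by apply: val_inj; rewrite val_dt ?invg1 //; exact: ga_comp1. Qed.

Lemma dt_bal g k a c a' :
  ga_comp g a -> ga_comp k c -> ga_comp (g * k)^-1%g a' ->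
  dt (g * k)%g (a * co_zeta A c) a' = dt g a (co_zeta A' c * a').
Proof.
move=> ag ck a'gk; apply: val_inj.
have zc : ga_comp k (co_zeta A c) by exact: co_zeta_comp.
have z'c : ga_comp k (co_zeta A' c) by exact: co_zeta_comp.
have azc : ga_comp (g * k)%g (a * co_zeta A c) by exact: ga_compM.
have zca : ga_comp g^-1%g (co_zeta A' c * a').
  by rewrite -[g^-1%g](mulKVg k) -invMg; exact: ga_compM.
by rewrite !val_dt // tC_bal.
Qed.
End DiagonalAlgebra.

Section TensorMaps.
Variables (M N M' N' : zmodType) (R : Type).
Variables (ra : M -> R -> M) (la : R -> N -> N).
Variables (ra' : M' -> R -> M') (la' : R -> N' -> N').

Definition tensor_map (f : M -> M') (g : N -> N') : tensor ra la -> tensor ra' la' :=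
  tensor_lift (fun m n => tens ra' la' (f m) (g n)).

Variables (f : M -> M') (g : N -> N').
Hypotheses (fD : addmap f) (gD : addmap g).
Hypothesis fR : forall m r, f (ra m r) = ra' (f m) r.
Hypothesis gR : forall r n, g (la r n) = la' r (g n).

Lemma tensor_map_balanced : balanced ra la (fun m n => tens ra' la' (f m) (g n)).
Proof.
split=> [n m1 m2|m n1 n2|m r n]; first by rewrite fD tensDl.
  by rewrite gD tensDr.
by rewrite fR gR tens_bal.
Qed.

Lemma tensor_mapE m n : tensor_map f g (tens ra la m n) = tens ra' la' (f m) (g n).
Proof. exact: tensor_liftE tensor_map_balanced _ _. Qed.

Lemma tensor_mapD : addmap (tensor_map f g).
Proof. exact: tensor_liftD tensor_map_balanced. Qed.
End TensorMaps.

Section TensorGradings.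
Variables (I : finType) (M N : zmodType) (R : Type).
Variables (ra : M -> R -> M) (la : R -> N -> N).

Definition tensor_compl (P : I -> set M) (i : I) : set (tensor ra la) :=
  addspan [set t | exists m n, P i m /\ t = tens ra la m n].

Definition tensor_compr (P : I -> set N) (i : I) : set (tensor ra la) :=
  addspan [set t | exists m n, P i n /\ t = tens ra la m n].

Lemma tensor_compl_sg P i : is_subgroup (P i) -> is_subgroup (tensor_compl P i).
Proof.
move=> sg; apply: addspan_subgroup => _ [m [n [Pm ->]]].
exists (- m), n; split; last by rewrite tensNl.
by rewrite -sub0r; exact: subgroupB sg (subgroup0 sg) Pm.
Qed.

Lemma tensor_compr_sg P i : is_subgroup (P i) -> is_subgroup (tensor_compr P i).
Proof.
move=> sg; apply: addspan_subgroup => _ [m [n [Pn ->]]].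
exists m, (- n); split; last by rewrite tensNr.
by rewrite -sub0r; exact: subgroupB sg (subgroup0 sg) Pn.
Qed.

Lemma tensor_compl_tens (P : I -> set M) i m n :
  P i m -> tensor_compl P i (tens ra la m n).
Proof. by move=> Pm; apply: addspan_sub; exists m, n. Qed.

Lemma tensor_compr_tens (P : I -> set N) i m n :
  P i n -> tensor_compr P i (tens ra la m n).
Proof. by move=> Pm; apply: addspan_sub; exists m, n. Qed.

Lemma tensor_gradingl (P : I -> set M) : is_grading P ->
  (forall r, addmap (ra^~ r)) -> (forall i m r, P i m -> P i (ra m r)) ->
  is_grading (tensor_compl P).
Proof.
move=> gP raD raP; have hR i m r : hcomp P i (ra m r) = ra (hcomp P i m) r.
  apply: (hom_ext gP (f := fun m => hcomp P i (ra m r))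
    (g := fun m => ra (hcomp P i m) r)) m.
  - by move=> x y; rewrite raD hcompD.
  - by move=> x y; rewrite hcompD // raD.
  move=> j m Pm; rewrite (hcomp_in gP i Pm) (hcomp_in gP i (raP _ _ r Pm)).
  by case: ifP => // _; rewrite (addmap0 (raD r)).
pose p i : tensor ra la -> tensor ra la := tensor_map ra la (hcomp P i) id.
have pE i m n : p i (tens ra la m n) = tens ra la (hcomp P i m) n.
  by apply: tensor_mapE => // ? ?; exact: hcompD.
have pD i : addmap (p i) by apply: tensor_mapD => // ? ?; exact: hcompD.
apply: (grading_of_proj (p := p)) => //.
- by move=> i; exact: tensor_compl_sg (gP.1 i).
- move=> i; have sg := tensor_compl_sg (gP.1 i).
  elim/tensor_ind => [|x y Px Py|m n].
  + by rewrite (addmap0 (pD i)); exact: subgroup0 sg.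
  + by rewrite pD; exact: subgroupD sg Px Py.
  + by rewrite pE; apply: tensor_compl_tens; exact: hcompP.
- apply: (tensor_ext (f := fun t => \sum_i p i t) (g := id)) => //.
    by move=> x y; rewrite -big_split; apply: eq_bigr => i _; exact: pD.
  move=> m n; rewrite -[in RHS](hcomp_sum gP m).
  rewrite (addmap_sum (f := fun m => tens ra la m n)).
    by apply: eq_bigr => i _; exact: pE.
  by move=> x y; exact: tensDl.
- move=> i j; apply: addspan_ind => [|x y ex ey|_ [m [n [Pm ->]]]].
  + by rewrite (addmap0 (pD j)) if_same.
  + by rewrite pD ex ey; case: ifP; rewrite ?addr0.
  + by rewrite pE (hcomp_in gP j Pm); case: ifP; rewrite ?tens0l.
Qed.

Lemma tensor_gradingr (P : I -> set N) : is_grading P ->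
  (forall r, addmap (la r)) -> (forall i r n, P i n -> P i (la r n)) ->
  is_grading (tensor_compr P).
Proof.
move=> gP laD laP; have hR i r n : hcomp P i (la r n) = la r (hcomp P i n).
  apply: (hom_ext gP (f := fun n => hcomp P i (la r n))
    (g := fun n => la r (hcomp P i n))) n.
  - by move=> x y; rewrite laD hcompD.
  - by move=> x y; rewrite hcompD // laD.
  move=> j n Pn; rewrite (hcomp_in gP i Pn) (hcomp_in gP i (laP _ r _ Pn)).
  by case: ifP => // _; rewrite (addmap0 (laD r)).
pose p i : tensor ra la -> tensor ra la := tensor_map ra la id (hcomp P i).
have pE i m n : p i (tens ra la m n) = tens ra la m (hcomp P i n).
  by apply: tensor_mapE => // ? ?; exact: hcompD.
have pD i : addmap (p i) by apply: tensor_mapD => // ? ?; exact: hcompD.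
apply: (grading_of_proj (p := p)) => //.
- by move=> i; exact: tensor_compr_sg (gP.1 i).
- move=> i; have sg := tensor_compr_sg (gP.1 i).
  elim/tensor_ind => [|x y Px Py|m n].
  + by rewrite (addmap0 (pD i)); exact: subgroup0 sg.
  + by rewrite pD; exact: subgroupD sg Px Py.
  + by rewrite pE; apply: tensor_compr_tens; exact: hcompP.
- apply: (tensor_ext (f := fun t => \sum_i p i t) (g := id)) => //.
    by move=> x y; rewrite -big_split; apply: eq_bigr => i _; exact: pD.
  move=> m n; rewrite -[in RHS](hcomp_sum gP n).
  rewrite (addmap_sum (f := fun n => tens ra la m n)).
    by apply: eq_bigr => i _; exact: pE.
  by move=> x y; exact: tensDr.
- move=> i j; apply: addspan_ind => [|x y ex ey|_ [m [n [Pn ->]]]].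
  + by rewrite (addmap0 (pD j)) if_same.
  + by rewrite pD ex ey; case: ifP; rewrite ?addr0.
  + by rewrite pE (hcomp_in gP j Pn); case: ifP; rewrite ?tens0r.
Qed.
End TensorGradings.

Record category := Category {
  cobj :> Type;
  chom : cobj -> cobj -> Type;
  idmor : forall X, chom X X;
  ccomp : forall X Y Z, chom Y Z -> chom X Y -> chom X Z;
  ccomp1f : forall X Y (f : chom X Y), ccomp (idmor Y) f = f;
  ccompf1 : forall X Y (f : chom X Y), ccomp f (idmor X) = f;
  ccompA : forall X Y Z W (f : chom Z W) (g : chom Y Z) (h : chom X Y),
    ccomp f (ccomp g h) = ccomp (ccomp f g) h }.

Record functor (X Y : category) := Functor {
  fobj :> X -> Y;
  fhom : forall U V : X, chom U V -> chom (fobj U) (fobj V);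
  fhom1 : forall U : X, fhom (idmor U) = idmor (fobj U);
  fhomM : forall (U V W : X) (f : chom V W) (g : chom U V),
    fhom (ccomp f g) = ccomp (fhom f) (fhom g) }.

Section Categories.
Definition is_iso (X : category) (U V : X) (f : chom U V) :=
  exists g : chom V U, ccomp g f = idmor U /\ ccomp f g = idmor V.

Definition nat_isomorphic (X Y : category) (F G : functor X Y) :=
  exists a : forall U : X, chom (F U) (G U), (forall U, is_iso (a U)) /\
    (forall (U V : X) (f : chom U V),
       ccomp (a V) (fhom F f) = ccomp (fhom G f) (a U)).

Definition id_functor (X : category) : functor X X :=
  @Functor X X id (fun _ _ f => f) (fun=> erefl) (fun _ _ _ _ _ => erefl).

Section CompFunctor.
Variables (X Y Z : category) (G : functor Y Z) (F : functor X Y).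

Lemma comp_functor1 (U : X) : fhom G (fhom F (idmor U)) = idmor (G (F U)).
Proof. by rewrite !fhom1. Qed.

Lemma comp_functorM (U V W : X) (f : chom V W) (g : chom U V) :
  fhom G (fhom F (ccomp f g)) = ccomp (fhom G (fhom F f)) (fhom G (fhom F g)).
Proof. by rewrite !fhomM. Qed.

Definition comp_functor : functor X Z := Functor comp_functor1 comp_functorM.
End CompFunctor.

Definition inverse_equivalences (X Y : category)
    (F : functor X Y) (G : functor Y X) :=
  nat_isomorphic (comp_functor G F) (id_functor X) /\
  nat_isomorphic (comp_functor F G) (id_functor Y).

Definition is_equivalence (X Y : category) (F : functor X Y) :=
  exists G : functor Y X, inverse_equivalences F G.
End Categories.

Section Modules.
Variable R : pzRingType.

Lemma linear_ext (U V : lmodType R) (f g : {linear U -> V}) : f =1 g -> f = g.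
Proof.
case: f g => f [[f1] [f2]] [g [[g1] [g2]]] /= /funext e.
by case: _ / e g1 g2 => g1 g2; rewrite (Prop_irrelevance f1 g1) (Prop_irrelevance f2 g2).
Qed.

Section MkLinear.
Variables (U V : lmodType R) (f : U -> V).
Hypotheses (fD : addmap f) (fZ : scalable f).

Lemma mk_linear_subproof : linear f.
Proof. by move=> k x y; rewrite fD fZ. Qed.

Definition mk_linear : {linear U -> V} :=
  HB.pack f (GRing.isLinear.Build R U V _ f mk_linear_subproof).
End MkLinear.

Definition mod_category : category := @Category (lmodType R)
  (fun U V => {linear U -> V}) (fun U => idfun : {linear U -> U})
  (fun U V W f g => (f \o g : {linear U -> W}))
  (fun _ _ f => linear_ext (f := idfun \o f) (g := f) (fun=> erefl))
  (fun _ _ f => linear_ext (f := f \o idfun) (g := f) (fun=> erefl))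
  (fun _ _ _ _ f g h =>
     linear_ext (f := f \o (g \o h)) (g := (f \o g) \o h) (fun=> erefl)).
End Modules.

Section GradedBimodules.
Variables (O : comPzRingType) (Gb : finGroupType).
Variable C : graded_acted_algebra O Gb.
Variables A A' : crossed_product_over C.

(** The left action is that of [lmodType A] and the right one is [gb_ract].
    By [gb_over] at scalars of [C], the two induced actions of [O] agree, and
    the components are [O]-submodules by [gb_compM]. *)
Record graded_bimodule := GradedBimodule {
  gb_sort :> lmodType A;
  gb_ract : gb_sort -> A' -> gb_sort;
  gb_ractDl : forall y, addmap (gb_ract^~ y);
  gb_ractDr : forall m, addmap (gb_ract m);
  gb_ract1 : forall m, gb_ract m 1 = m;
  gb_ractM : forall m y z, gb_ract m (y * z) = gb_ract (gb_ract m y) z;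
  gb_ractZ : forall x m y, gb_ract (x *: m) y = x *: gb_ract m y;
  gb_comp : Gb -> set gb_sort;
  gb_grading : is_grading gb_comp;
  gb_compM : forall g x h a m a',
    ga_comp g a -> gb_comp x m -> ga_comp h a' ->
    gb_comp (g * x * h)%g (gb_ract (a *: m) a');
  gb_over : forall g m c, gb_comp g m ->
    gb_ract m (co_zeta A' c) = co_zeta A (gaa_act C g c) *: m }.

Record gb_hom (M N : graded_bimodule) := GbHom {
  gb_fun :> {linear M -> N};
  gb_fun_ract : forall m y, gb_fun (gb_ract m y) = gb_ract (gb_fun m) y;
  gb_fun_comp : forall x m, gb_comp x m -> gb_comp x (gb_fun m) }.

Lemma gb_hom_ext (M N : graded_bimodule) (f g : gb_hom M N) : f =1 g -> f = g.
Proof.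
case: f g => f fr fc [g gr gc] /= /linear_ext e.
case: _ / e gr gc => gr gc.
by rewrite (Prop_irrelevance fr gr) (Prop_irrelevance fc gc).
Qed.

Definition gb_id (M : graded_bimodule) : gb_hom M M :=
  @GbHom M M (idfun : {linear M -> M}) (fun _ _ => erefl) (fun _ _ mx => mx).

Section Comp.
Variables (M N P : graded_bimodule) (f : gb_hom N P) (g : gb_hom M N).

Lemma gb_comp_ract m y : (f \o g) (gb_ract m y) = gb_ract ((f \o g) m) y.
Proof. by rewrite /= !gb_fun_ract. Qed.

Lemma gb_comp_comp x m : gb_comp x m -> gb_comp x ((f \o g) m).
Proof. by move=> mx; do 2!apply: gb_fun_comp. Qed.

Definition gb_hcomp : gb_hom M P :=
  @GbHom M P (f \o g : {linear M -> P}) gb_comp_ract gb_comp_comp.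
End Comp.

Definition graded_bimodule_category : category :=
  @Category graded_bimodule gb_hom gb_id gb_hcomp
    (fun _ _ f => gb_hom_ext (f := gb_hcomp (gb_id _) f) (g := f) (fun=> erefl))
    (fun _ _ f => gb_hom_ext (f := gb_hcomp f (gb_id _)) (g := f) (fun=> erefl))
    (fun _ _ _ _ f g h => gb_hom_ext (f := gb_hcomp f (gb_hcomp g h))
       (g := gb_hcomp (gb_hcomp f g) h) (fun=> erefl)).

Notation T := (tensC A A').
Notation D := (diag A A').
Notation dt := (@dt O Gb C A A').

Section Functor1.
Variable M : lmodType D.

Definition tens_over_diag := tensor
  (fun (t : T) (d : D) => tC_mul t (val d)) (fun (d : D) (m : M) => d *: m).
HB.instance Definition _ := GRing.Zmodule.on tens_over_diag.

Definition t1 (t : T) (m : M) : tens_over_diag := tens _ _ t m.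

Definition ten1_map (f : T -> T) : tens_over_diag -> tens_over_diag := tensor_map _ _ f id.

Lemma ten1_ind (P : tens_over_diag -> Prop) : P 0 ->
  (forall x y, P x -> P y -> P (x + y)) -> (forall t m, P (t1 t m)) ->
  forall x, P x.
Proof. exact: tensor_ind. Qed.

Section Map.
Variables (f : T -> T) (fD : addmap f).
Hypothesis fM : forall t s : T, diag_set s -> f (tC_mul t s) = tC_mul (f t) s.

Lemma ten1_mapE t m : ten1_map f (t1 t m) = t1 (f t) m.
Proof. by apply: tensor_mapE => // s d; exact: fM (diagP d). Qed.

Lemma ten1_mapD : addmap (ten1_map f).
Proof. by apply: tensor_mapD => // s d; exact: fM (diagP d). Qed.
End Map.

Definition ten1_lact (x : A) : tens_over_diag -> tens_over_diag := ten1_map (fun t => x *: t).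
Definition ten1_ract (v : tens_over_diag) (y : A') : tens_over_diag := ten1_map (fun t => tC_ract t y) v.

Lemma tC_mul_lact x (t s : T) : diag_set s -> x *: tC_mul t s = tC_mul (x *: t) s.
Proof.
move=> sD; elim/diag_ind: s / sD => [|s r sD rD es er|g d d' dg d'g].
- by rewrite !(addmap0 (tC_mulDr _)) scaler0.
- by rewrite !tC_mulDr scalerDr es er.
have dD := diag_tens dg d'g.
elim/tensC_ind: t => [|t s et es|a a'].
- by rewrite (addmap0 (tC_mulDl dD)) !scaler0 (addmap0 (tC_mulDl dD)).
- by rewrite (tC_mulDl dD) !scalerDr et es (tC_mulDl dD).
by rewrite tC_scaleE !(tC_mulE _ _ dg d'g) tC_scaleE mulrA.
Qed.

Lemma tC_mul_ract y (t s : T) : diag_set s -> tC_ract (tC_mul t s) y = tC_mul (tC_ract t y) s.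
Proof.
move=> sD; elim/diag_ind: s / sD => [|s r sD rD es er|g d d' dg d'g].
- by rewrite !(addmap0 (tC_mulDr _)) (addmap0 (tC_ractD _)).
- by rewrite !tC_mulDr tC_ractD es er.
have dD := diag_tens dg d'g.
elim/tensC_ind: t => [|t s et es|a a'].
- by rewrite (addmap0 (tC_mulDl dD)) !(addmap0 (tC_ractD _)) (addmap0 (tC_mulDl dD)).
- by rewrite (tC_mulDl dD) !tC_ractD et es (tC_mulDl dD).
by rewrite tC_ractE !(tC_mulE _ _ dg d'g) tC_ractE mulrA.
Qed.

Lemma tC_comp_mul x (t s : T) : diag_set s -> tC_comp x t -> tC_comp x (tC_mul t s).
Proof.
have sg := tC_comp_sg A A' x.
move=> sD; move: t; apply: addspan_ind => [|t r et er|_ [k [h [a [a' [<- ak a'h ->]]]]]].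
- by rewrite (addmap0 (tC_mulDl sD)); exact: subgroup0 sg.
- by rewrite (tC_mulDl sD); exact: subgroupD sg et er.

clear sg; have sg := tC_comp_sg A A' (k * h)%g.
elim/diag_ind: s / sD => [|s r sD rD es er|g d d' dg d'g].
- by rewrite (addmap0 (tC_mulDr _)); exact: subgroup0 sg.
- by rewrite tC_mulDr; exact: subgroupD sg es er.
rewrite (tC_mulE _ _ dg d'g).
have -> : (k * h = (k * g) * (g^-1 * h))%g by rewrite mulgA mulgK.
by apply: tC_comp_tens; exact: ga_compM.
Qed.

Lemma ten1_lactE x t m : ten1_lact x (t1 t m) = t1 (x *: t) m.
Proof. by apply: ten1_mapE => [u v|u s]; [exact: scalerDr|exact: tC_mul_lact]. Qed.
Lemma ten1_lactD x : addmap (ten1_lact x).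
Proof. by apply: ten1_mapD => [u v|u s]; [exact: scalerDr|exact: tC_mul_lact]. Qed.
Lemma ten1_ractE y t m : ten1_ract (t1 t m) y = t1 (tC_ract t y) m.
Proof. by apply: ten1_mapE => [u v|u s]; [exact: tC_ractD|exact: tC_mul_ract]. Qed.
Lemma ten1_ractD y : addmap (ten1_ract^~ y).
Proof. by apply: ten1_mapD => [u v|u s]; [exact: tC_ractD|exact: tC_mul_ract]. Qed.

Lemma ten1_lactA x y v : ten1_lact x (ten1_lact y v) = ten1_lact (x * y) v.
Proof.
elim/ten1_ind: v => [|v w ev ew|t m].
- by rewrite !(addmap0 (ten1_lactD _)).
- by rewrite !ten1_lactD ev ew.
by rewrite !ten1_lactE scalerA.
Qed.

Lemma ten1_lact1 v : ten1_lact 1 v = v.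
Proof.
elim/ten1_ind: v => [|v w ev ew|t m].
- by rewrite !(addmap0 (ten1_lactD _)).
- by rewrite !ten1_lactD ev ew.
by rewrite !ten1_lactE scale1r.
Qed.

Lemma ten1_lactDl v x y : ten1_lact (x + y) v = ten1_lact x v + ten1_lact y v.
Proof.
elim/ten1_ind: v => [|v w ev ew|t m].
- by rewrite !(addmap0 (ten1_lactD _)) addr0.
- by rewrite !ten1_lactD ev ew addrACA.
by rewrite !ten1_lactE scalerDl /t1 tensDl.
Qed.

HB.instance Definition _ := GRing.Zmodule_isLmodule.Build A tens_over_diag
  ten1_lactA ten1_lact1 ten1_lactD ten1_lactDl.

Lemma ten1_scaleE x t m : x *: t1 t m = t1 (x *: t) m.
Proof. exact: ten1_lactE. Qed.

Definition ten1_comp : Gb -> set tens_over_diag := tensor_compl (@tC_comp _ _ _ A A').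

Lemma tC_ract_add (t : T) y z : tC_ract t (y + z) = tC_ract t y + tC_ract t z.
Proof.
elim/tensC_ind: t => [|t s et es|a a'].
- by rewrite !(addmap0 (tC_ractD _)) addr0.
- by rewrite !tC_ractD et es addrACA.
by rewrite !tC_ractE mulrDr tCDr.
Qed.

Lemma tC_ractA (t : T) y z : tC_ract t (y * z) = tC_ract (tC_ract t y) z.
Proof.
elim/tensC_ind: t => [|t s et es|a a'].
- by rewrite !(addmap0 (tC_ractD _)).
- by rewrite !tC_ractD et es.
by rewrite !tC_ractE mulrA.
Qed.

Lemma tC_ract1 (t : T) : tC_ract t 1 = t.
Proof.
elim/tensC_ind: t => [|t s et es|a a'].
- by rewrite !(addmap0 (tC_ractD _)).
- by rewrite !tC_ractD et es.
by rewrite !tC_ractE mulr1.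
Qed.

Lemma tC_ractZ x (t : T) y : tC_ract (x *: t) y = x *: tC_ract t y.
Proof.
elim/tensC_ind: t => [|t s et es|a a'].
- by rewrite !(addmap0 (tC_ractD _)) scaler0 (addmap0 (tC_ractD _)).
- by rewrite scalerDr !tC_ractD scalerDr et es.
by rewrite tC_scaleE !tC_ractE tC_scaleE.
Qed.

Lemma tC_bicomp g x h a (t : T) a' : ga_comp g a -> tC_comp x t -> ga_comp h a' ->
  tC_comp (g * x * h)%g (tC_ract (a *: t) a').
Proof.
move=> ag; have sg := tC_comp_sg A A' (g * x * h)%g.
move=> tx a'h; move: t tx; apply: addspan_ind => [|t s et es|_ [k [l [d [d' [e dk d'l ->]]]]]].
- by rewrite scaler0 (addmap0 (tC_ractD _)); exact: subgroup0 sg.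
- by rewrite scalerDr tC_ractD; exact: subgroupD sg et es.
have -> : (g * x * h = (g * k) * (l * h))%g by rewrite -e !mulgA.
rewrite tC_scaleE tC_ractE; by apply: tC_comp_tens; exact: ga_compM.
Qed.

Lemma tC_over g (t : T) c : tC_comp g t ->
  tC_ract t (co_zeta A' c) = co_zeta A (gaa_act C g c) *: t.
Proof.
move: t; apply: addspan_ind => [|t s et es|_ [k [l [d [d' [<- dk d'l ->]]]]]].
- by rewrite scaler0 (addmap0 (tC_ractD _)).
- by rewrite scalerDr tC_ractD et es.
by rewrite tC_scaleE tC_ractE gaa_actM (co_zetaC _ d'l) -tC_bal (co_zetaC _ dk).
Qed.

Lemma ten1_ractDr v : addmap (ten1_ract v).
Proof.
move=> y z; elim/ten1_ind: v => [|v w ev ew|t m].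
- by rewrite !(addmap0 (ten1_ractD _)) addr0.
- by rewrite !ten1_ractD ev ew addrACA.
by rewrite !ten1_ractE tC_ract_add /t1 tensDl.
Qed.

Lemma ten1_ract1 v : ten1_ract v 1 = v.
Proof.
elim/ten1_ind: v => [|v w ev ew|t m].
- by rewrite !(addmap0 (ten1_ractD _)).
- by rewrite !ten1_ractD ev ew.
by rewrite !ten1_ractE tC_ract1.
Qed.

Lemma ten1_ractM v y z : ten1_ract v (y * z) = ten1_ract (ten1_ract v y) z.
Proof.
elim/ten1_ind: v => [|v w ev ew|t m].
- by rewrite !(addmap0 (ten1_ractD _)).
- by rewrite !ten1_ractD ev ew.
by rewrite !ten1_ractE tC_ractA.
Qed.

Lemma ten1_ractZ x v y : ten1_ract (x *: v) y = x *: ten1_ract v y.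
Proof.
elim/ten1_ind: v => [|v w ev ew|t m].
- by rewrite scaler0 !(addmap0 (ten1_ractD _)) scaler0.
- by rewrite scalerDr !ten1_ractD scalerDr ev ew.
by rewrite ten1_scaleE !ten1_ractE ten1_scaleE tC_ractZ.
Qed.

Lemma ten1_grading : is_grading ten1_comp.
Proof.
apply: tensor_gradingl; first exact: tC_grading.
  by move=> d; exact: tC_mulDl (diagP d).
by move=> i t d; exact: tC_comp_mul (diagP d).
Qed.

Lemma ten1_compM g x h a v a' : ga_comp g a -> ten1_comp x v -> ga_comp h a' ->
  ten1_comp (g * x * h)%g (ten1_ract (a *: v) a').
Proof.
move=> ag vx a'h; have sg := ten1_grading.1 (g * x * h)%g.
move: v vx; apply: addspan_ind => [|v w ev ew|_ [t [m [tx ->]]]].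
- by rewrite scaler0 (addmap0 (ten1_ractD _)); exact: subgroup0 sg.
- by rewrite scalerDr ten1_ractD; exact: subgroupD sg ev ew.
rewrite ten1_scaleE ten1_ractE.
by apply: tensor_compl_tens; exact: tC_bicomp.
Qed.

Lemma ten1_over g v c : ten1_comp g v ->
  ten1_ract v (co_zeta A' c) = co_zeta A (gaa_act C g c) *: v.
Proof.
move: v; apply: addspan_ind => [|v w ev ew|_ [t [m [tx ->]]]].
- by rewrite scaler0 (addmap0 (ten1_ractD _)).
- by rewrite scalerDr ten1_ractD ev ew.
by rewrite ten1_scaleE ten1_ractE (tC_over _ tx).
Qed.

Definition gb_tens_over_diag : graded_bimodule :=
  @GradedBimodule tens_over_diag ten1_ract ten1_ractD ten1_ractDr ten1_ract1 ten1_ractM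
    ten1_ractZ ten1_comp ten1_grading ten1_compM ten1_over.
End Functor1.

Section Functor1Map.
Variables (M N : lmodType D) (f : {linear M -> N}).

Definition ten1_hom : tens_over_diag M -> tens_over_diag N := tensor_map _ _ id f.

Lemma ten1_homE t m : ten1_hom (t1 t m) = t1 t (f m).
Proof.
by apply: tensor_mapE => // [u v|d u]; [exact: raddfD|exact: linearZ].
Qed.

Lemma ten1_homD : addmap ten1_hom.
Proof.
by apply: tensor_mapD => // [u v|d u]; [exact: raddfD|exact: linearZ].
Qed.

Lemma ten1_homZ : scalable ten1_hom.
Proof.
move=> x; elim/ten1_ind => [|v w ev ew|t m].
- by rewrite scaler0 !(addmap0 ten1_homD) scaler0.
- by rewrite scalerDr !ten1_homD scalerDr ev ew.
by rewrite ten1_scaleE !ten1_homE ten1_scaleE.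
Qed.

Lemma ten1_hom_ract v y : ten1_hom (ten1_ract v y) = ten1_ract (ten1_hom v) y.
Proof.
elim/ten1_ind: v => [|v w ev ew|t m].
- by rewrite (addmap0 (ten1_ractD _)) !(addmap0 ten1_homD) (addmap0 (ten1_ractD _)).
- by rewrite ten1_ractD !ten1_homD ten1_ractD ev ew.
by rewrite ten1_ractE !ten1_homE ten1_ractE.
Qed.

Lemma ten1_hom_comp x v : ten1_comp x v -> ten1_comp x (ten1_hom v).
Proof.
have sg := (ten1_grading N).1 x.
move: v; apply: addspan_ind => [|v w ev ew|_ [t [m [tx ->]]]].
- by rewrite (addmap0 ten1_homD); exact: subgroup0 sg.
- by rewrite ten1_homD; exact: subgroupD sg ev ew.
by rewrite ten1_homE; exact: tensor_compl_tens.
Qed.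

Definition gb_ten1_hom : gb_hom (gb_tens_over_diag M) (gb_tens_over_diag N) :=
  @GbHom (gb_tens_over_diag M) (gb_tens_over_diag N) (mk_linear ten1_homD ten1_homZ) ten1_hom_ract ten1_hom_comp.
End Functor1Map.

Lemma gb_ten1_hom1 (M : lmodType D) :
  gb_ten1_hom (idfun : {linear M -> M}) = gb_id (gb_tens_over_diag M).
Proof.
apply: gb_hom_ext; apply: (tensor_ext (g := id)) => //; first exact: ten1_homD.
by move=> t m; exact: ten1_homE.
Qed.

Lemma gb_ten1_homM (M N P : lmodType D) (f : {linear N -> P}) (g : {linear M -> N}) :
  gb_ten1_hom (f \o g : {linear M -> P}) = gb_hcomp (gb_ten1_hom f) (gb_ten1_hom g).
Proof.
apply: gb_hom_ext; apply: (tensor_ext (g := ten1_hom f \o ten1_hom g)) => //.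
- exact: ten1_homD.
- by move=> x y /=; rewrite !ten1_homD.
by move=> t m /=; rewrite [LHS]ten1_homE [X in ten1_hom f X]ten1_homE [RHS]ten1_homE.
Qed.

Definition tens_over_diag_functor :
    functor (mod_category (diag A A')) graded_bimodule_category :=
  @Functor (mod_category (diag A A')) graded_bimodule_category
    gb_tens_over_diag gb_ten1_hom gb_ten1_hom1 gb_ten1_homM.

End GradedBimodules.

Section Functors.
Variables (O : comPzRingType) (Gb : finGroupType).
Variable C : graded_acted_algebra O Gb.
Variables A A' : crossed_product_over C.

Notation T := (tensC A A').
Notation D := (diag A A').
Notation dt := (@dt O Gb C A A').

Lemma hc_mulr (E : graded_algebra O Gb) g (a b : E) :
  ga_comp 1%g b -> hc g (a * b) = hc g a * b.
Proof.
move=> b1; apply: (hom_ext (@ga_grading _ _ E)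
  (f := fun a => hc g (a * b)) (g := fun a => hc g a * b)) a.
- by move=> x y; rewrite mulrDl hcD.
- by move=> x y; rewrite hcD mulrDl.
move=> h a ah; rewrite (hc_in _ ah) (@hc_in _ _ _ h).
  by case: ifP => // _; rewrite mul0r.
by rewrite -[X in ga_comp X _]mulg1; exact: ga_compM.
Qed.

Lemma hc_mull (E : graded_algebra O Gb) g (a b : E) :
  ga_comp 1%g b -> hc g (b * a) = b * hc g a.
Proof.
move=> b1; apply: (hom_ext (@ga_grading _ _ E)
  (f := fun a => hc g (b * a)) (g := fun a => b * hc g a)) a.
- by move=> x y; rewrite mulrDr hcD.
- by move=> x y; rewrite hcD mulrDr.
move=> h a ah; rewrite (hc_in _ ah) (@hc_in _ _ _ h).
  by case: ifP => // _; rewrite mulr0.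
by rewrite -[X in ga_comp X _]mul1g; exact: ga_compM.
Qed.

Lemma val_dt1 (b : A) (b' : A') : ga_comp 1%g b -> ga_comp 1%g b' ->
  val (dt 1%g b b') = tC b b'.
Proof. by move=> b1 b'1; rewrite val_dt ?invg1. Qed.

Lemma dt_mul1r g (a b : A) (a' b' : A') : ga_comp 1%g b -> ga_comp 1%g b' ->
  dt g a a' * dt 1%g b b' = dt g (a * b) (b' * a').
Proof.
move=> b1 b'1; apply: val_inj; rewrite val_diagM val_dt1 // (@tC_mulE _ _ _ _ _ 1%g) ?invg1 //=.
by rewrite (hc_mulr _ _ b1) (hc_mull _ _ b'1).
Qed.

Lemma dt_mul1l g (a b : A) (a' b' : A') : ga_comp 1%g b -> ga_comp 1%g b' ->
  dt 1%g b b' * dt g a a' = dt g (b * a) (a' * b').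
Proof.
move=> b1 b'1; apply: val_inj; rewrite val_diagM val_dt1 // (@tC_mulE _ _ _ _ _ g); try exact: hcP.
by rewrite /= (hc_mull _ _ b1) (hc_mulr _ _ b'1).
Qed.

Definition comp1_of (E : graded_algebra O Gb) := {b : E | ga_comp 1%g b}.

(** [A (x)_B M], where [b m = (b (x) 1) m] *)
Section Functor2.
Variable M : lmodType D.

Definition tens_over_B := tensor
  (fun (a : A) (b : comp1_of A) => a * sval b)
  (fun (b : comp1_of A) (m : M) => dt 1%g (sval b) 1 *: m).
HB.instance Definition _ := GRing.Zmodule.on tens_over_B.

Definition t2 (a : A) (m : M) : tens_over_B := tens _ _ a m.

Lemma t2Dl a b m : t2 (a + b) m = t2 a m + t2 b m. Proof. exact: tensDl. Qed.
Lemma t2Dr a m n : t2 a (m + n) = t2 a m + t2 a n. Proof. exact: tensDr. Qed.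
Lemma t2_bal a b m : ga_comp 1%g b -> t2 (a * b) m = t2 a (dt 1%g b 1 *: m).
Proof. by move=> b1; exact: (@tens_bal _ _ _ _ _ a (exist _ b b1) m). Qed.

Lemma ten2_ind (P : tens_over_B -> Prop) : P 0 ->
  (forall x y, P x -> P y -> P (x + y)) -> (forall a m, P (t2 a m)) ->
  forall x, P x.
Proof. exact: tensor_ind. Qed.

Definition ten2_lact (x : A) : tens_over_B -> tens_over_B := tensor_map _ _ (fun a => x * a) id.

Lemma ten2_lactE x a m : ten2_lact x (t2 a m) = t2 (x * a) m.
Proof. by apply: tensor_mapE => // [u v|u b]; [exact: mulrDr|rewrite mulrA]. Qed.
Lemma ten2_lactD x : addmap (ten2_lact x).
Proof. by apply: tensor_mapD => // [u v|u b]; [exact: mulrDr|rewrite mulrA]. Qed.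

Lemma ten2_lactA x y v : ten2_lact x (ten2_lact y v) = ten2_lact (x * y) v.
Proof.
elim/ten2_ind: v => [|v w ev ew|a m].
- by rewrite !(addmap0 (ten2_lactD _)).
- by rewrite !ten2_lactD ev ew.
by rewrite !ten2_lactE mulrA.
Qed.

Lemma ten2_lact1 v : ten2_lact 1 v = v.
Proof.
elim/ten2_ind: v => [|v w ev ew|a m].
- by rewrite !(addmap0 (ten2_lactD _)).
- by rewrite !ten2_lactD ev ew.
by rewrite !ten2_lactE mul1r.
Qed.

Lemma ten2_lactDl v x y : ten2_lact (x + y) v = ten2_lact x v + ten2_lact y v.
Proof.
elim/ten2_ind: v => [|v w ev ew|a m].
- by rewrite !(addmap0 (ten2_lactD _)) addr0.
- by rewrite !ten2_lactD ev ew addrACA.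
by rewrite !ten2_lactE mulrDl t2Dl.
Qed.

HB.instance Definition _ := GRing.Zmodule_isLmodule.Build A tens_over_B
  ten2_lactA ten2_lact1 ten2_lactD ten2_lactDl.

Lemma ten2_scaleE x a m : x *: t2 a m = t2 (x * a) m.
Proof. exact: ten2_lactE. Qed.

(** [(a (x) m) a'_h = a u_h (x) (u_h^-1 (x) a'_h) m], summed over [h]: the
    element [dt h^-1 (u_h^-1) a'] only involves the component [a'_h]. *)
Definition ten2_ractf (y : A') (a : A) (m : M) : tens_over_B :=
  \sum_h t2 (a * cp_u A h) (dt h^-1%g (cp_uV A h) y *: m).
Definition ten2_ract (v : tens_over_B) (y : A') : tens_over_B := tensor_lift (ten2_ractf y) v.

(* the choice of the unit in degree g is irrelevant *)
Lemma t2_unit a m g v w y : ga_comp g v -> ga_comp g^-1%g w -> v * w = 1 ->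
  t2 (a * v) (dt g^-1%g w y *: m) =
  t2 (a * cp_u A g) (dt g^-1%g (cp_uV A g) y *: m).
Proof.
move=> vg wg vw; have b1 : ga_comp 1%g (cp_uV A g * v).
  by rewrite -(mulVg g); apply: ga_compM => //; exact: cp_uV_comp.
have -> : a * v = a * cp_u A g * (cp_uV A g * v).
  by rewrite -mulrA [cp_u A g * _]mulrA cp_uuV mul1r.
rewrite t2_bal // scalerA dt_mul1l //; last exact: ga_comp1.
by rewrite -mulrA vw !mulr1.
Qed.

Lemma ten2_ractf_bal y : balanced (fun (a : A) (b : comp1_of A) => a * sval b)
  (fun (b : comp1_of A) (m : M) => dt 1%g (sval b) 1 *: m) (ten2_ractf y).
Proof.
split=> [m a b|a m n|a [b b1] m]; rewrite /ten2_ractf.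
- by rewrite -big_split; apply: eq_bigr => h _; rewrite mulrDl t2Dl.
- by rewrite -big_split; apply: eq_bigr => h _; rewrite scalerDr t2Dr.
apply: eq_bigr => h _ /=.
have c1 : ga_comp 1%g (cp_uV A h * b * cp_u A h).
  rewrite -(mulVg h) -[h^-1%g]mulg1; apply: ga_compM; last exact: cp_u_comp.
  by apply: ga_compM => //; exact: cp_uV_comp.
have -> : a * b * cp_u A h = a * cp_u A h * (cp_uV A h * b * cp_u A h).
  by rewrite !mulrA -[_ * _ * cp_uV A h]mulrA cp_uuV mulr1.
rewrite t2_bal // !scalerA dt_mul1l ?dt_mul1r //; try exact: ga_comp1.
by rewrite mulr1 mul1r -mulrA cp_uuV mulr1.
Qed.

Lemma ten2_ractE y a m : ten2_ract (t2 a m) y = ten2_ractf y a m.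
Proof. exact: tensor_liftE (ten2_ractf_bal y) _ _. Qed.
Lemma ten2_ractD y : addmap (ten2_ract^~ y).
Proof. exact: tensor_liftD (ten2_ractf_bal y). Qed.

Lemma dt0r g a : dt g a 0 = 0.
Proof. by apply: (addmap0 (f := dt g a)) => x y; exact: dtDr. Qed.

Lemma dt_out g h a y : ga_comp h y -> g^-1%g != h -> dt g a y = 0.
Proof.
by move=> yh gh; apply: val_inj; rewrite /= (hc_in _ yh) (negPf gh) /tC tens0r.
Qed.

Lemma ten2_ract_hom y h a m : ga_comp h y ->
  ten2_ract (t2 a m) y = t2 (a * cp_u A h) (dt h^-1%g (cp_uV A h) y *: m).
Proof.
move=> yh; rewrite ten2_ractE /ten2_ractf (bigD1 h) //= big1 ?addr0 // => k kh.
by rewrite (dt_out _ yh) ?invgK // scale0r /t2 tens0r.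
Qed.

Lemma ten2_ractDr v : addmap (ten2_ract v).
Proof.
move=> y z; elim/ten2_ind: v => [|v w ev ew|a m].
- by rewrite !(addmap0 (ten2_ractD _)) addr0.
- by rewrite !ten2_ractD ev ew addrACA.
rewrite !ten2_ractE /ten2_ractf -big_split; apply: eq_bigr => h _ /=.
by rewrite dtDr scalerDl t2Dr.
Qed.

Lemma ten2_ract1 v : ten2_ract v 1 = v.
Proof.
elim/ten2_ind: v => [|v w ev ew|a m].
- by rewrite !(addmap0 (ten2_ractD _)).
- by rewrite !ten2_ractD ev ew.
rewrite (ten2_ract_hom _ _ (ga_comp1 A')).
rewrite -(@t2_unit _ _ 1%g 1 1) ?mulr1 ?invg1 //; try exact: ga_comp1.
by rewrite dt1 scale1r.
Qed.

Lemma ten2_ractM v y z : ten2_ract v (y * z) = ten2_ract (ten2_ract v y) z.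
Proof.
elim/ten2_ind: v => [|v w ev ew|a m].
- by rewrite !(addmap0 (ten2_ractD _)).
- by rewrite !ten2_ractD ev ew.
apply: (hom_ext (@ga_grading _ _ A') (f := fun y => ten2_ract (t2 a m) (y * z))
  (g := fun y => ten2_ract (ten2_ract (t2 a m) y) z)).
- by move=> x x'; rewrite mulrDl ten2_ractDr.
- by move=> x x'; rewrite ten2_ractDr ten2_ractD.
move=> h {}y yh.
apply: (hom_ext (@ga_grading _ _ A') (f := fun z => ten2_ract (t2 a m) (y * z))
  (g := fun z => ten2_ract (ten2_ract (t2 a m) y) z)).
- by move=> x x'; rewrite mulrDr ten2_ractDr.
- by move=> x x'; rewrite ten2_ractDr.
move=> k {}z zk; have yz := ga_compM yh zk.
rewrite (ten2_ract_hom _ _ yh) (ten2_ract_hom _ _ zk) (ten2_ract_hom _ _ yz).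
have uVh := cp_uV_comp A h; have uVk := cp_uV_comp A k.
rewrite scalerA dtM ?invgK // -invMg -(@t2_unit _ _ _ (cp_u A h * cp_u A k) (cp_uV A k * cp_uV A h)).
- by rewrite mulrA.
- by apply: ga_compM; exact: cp_u_comp.
- by rewrite invMg; exact: ga_compM.
- by rewrite mulrA -[_ * _ * cp_uV A k]mulrA cp_uuV mulr1 cp_uuV.
Qed.

Lemma ten2_ractZ x v y : ten2_ract (x *: v) y = x *: ten2_ract v y.
Proof.
elim/ten2_ind: v => [|v w ev ew|a m].
- by rewrite scaler0 !(addmap0 (ten2_ractD _)) scaler0.
- by rewrite scalerDr !ten2_ractD scalerDr ev ew.
rewrite ten2_scaleE !ten2_ractE /ten2_ractf scaler_sumr.
by apply: eq_bigr => h _; rewrite ten2_scaleE mulrA.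
Qed.

Definition ten2_comp : Gb -> set tens_over_B := tensor_compl (@ga_comp _ _ A).

Lemma ten2_grading : is_grading ten2_comp.
Proof.
apply: tensor_gradingl; first exact: ga_grading.
  by move=> b x y; exact: mulrDl.
move=> g a [b b1] ag /=; rewrite -[X in ga_comp X _]mulg1; exact: ga_compM.
Qed.

Lemma ten2_compM g x h a v a' : ga_comp g a -> ten2_comp x v -> ga_comp h a' ->
  ten2_comp (g * x * h)%g (ten2_ract (a *: v) a').
Proof.
move=> ag vx a'h; have sg := ten2_grading.1 (g * x * h)%g.
move: v vx; apply: addspan_ind => [|v w ev ew|_ [d [m [dx ->]]]].
- by rewrite scaler0 (addmap0 (ten2_ractD _)); exact: subgroup0 sg.
- by rewrite scalerDr ten2_ractD; exact: subgroupD sg ev ew.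
rewrite ten2_scaleE (ten2_ract_hom _ _ a'h).
apply: tensor_compl_tens; apply: ga_compM; last exact: cp_u_comp.
exact: ga_compM.
Qed.

Lemma ten2_ract_zeta a m c :
  ten2_ract (t2 a m) (co_zeta A' c) = t2 (a * co_zeta A c) m.
Proof.
apply: (hom_ext (@ga_grading _ _ C)
  (f := fun c => ten2_ract (t2 a m) (co_zeta A' c))
  (g := fun c => t2 (a * co_zeta A c) m)).
- by move=> x y; rewrite rmorphD ten2_ractDr.
- by move=> x y; rewrite rmorphD mulrDr t2Dl.
move=> k {}c ck; have zc : ga_comp k (co_zeta A c) by exact: co_zeta_comp.
have z'c : ga_comp k (co_zeta A' c) by exact: co_zeta_comp.
have uVk := cp_uV_comp A k.
rewrite (ten2_ract_hom _ _ z'c) -[co_zeta A' c]mulr1 -(dt_bal (k := k)) //; last first.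
  by rewrite mulVg invg1; exact: ga_comp1.
rewrite mulVg -t2_bal; last by rewrite -(mulVg k); exact: ga_compM.
by rewrite mulrA -[_ * _ * cp_uV A k]mulrA cp_uuV mulr1.
Qed.

Lemma ten2_over g v c : ten2_comp g v ->
  ten2_ract v (co_zeta A' c) = co_zeta A (gaa_act C g c) *: v.
Proof.
move: v; apply: addspan_ind => [|v w ev ew|_ [a [m [ag ->]]]].
- by rewrite scaler0 (addmap0 (ten2_ractD _)).
- by rewrite scalerDr ten2_ractD ev ew.
by rewrite ten2_scaleE ten2_ract_zeta (co_zetaC _ ag).
Qed.

Definition gb_tens_over_B : graded_bimodule A A' :=
  @GradedBimodule _ _ _ A A' tens_over_B ten2_ract ten2_ractD ten2_ractDr ten2_ract1
    ten2_ractM ten2_ractZ ten2_comp ten2_grading ten2_compM ten2_over.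
End Functor2.

Section Functor2Map.
Variables (M N : lmodType D) (f : {linear M -> N}).

Definition ten2_hom : tens_over_B M -> tens_over_B N := tensor_map _ _ id f.

Lemma ten2_homE a m : ten2_hom (t2 a m) = t2 a (f m).
Proof.
by apply: tensor_mapE => // [u v|b u]; [exact: raddfD|exact: linearZ].
Qed.

Lemma ten2_homD : addmap ten2_hom.
Proof.
by apply: tensor_mapD => // [u v|b u]; [exact: raddfD|exact: linearZ].
Qed.

Lemma ten2_homZ : scalable ten2_hom.
Proof.
move=> x; elim/ten2_ind => [|v w ev ew|a m].
- by rewrite scaler0 !(addmap0 ten2_homD) scaler0.
- by rewrite scalerDr !ten2_homD scalerDr ev ew.
by rewrite ten2_scaleE !ten2_homE ten2_scaleE.
Qed.

Lemma ten2_hom_ract v y : ten2_hom (ten2_ract v y) = ten2_ract (ten2_hom v) y.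
Proof.
elim/ten2_ind: v => [|v w ev ew|a m].
- by rewrite (addmap0 (ten2_ractD _)) !(addmap0 ten2_homD) (addmap0 (ten2_ractD _)).
- by rewrite ten2_ractD !ten2_homD ten2_ractD ev ew.
rewrite ten2_homE !ten2_ractE /ten2_ractf (addmap_sum ten2_homD).
by apply: eq_bigr => h _; rewrite ten2_homE linearZ.
Qed.

Lemma ten2_hom_comp x v : ten2_comp x v -> ten2_comp x (ten2_hom v).
Proof.
have sg := (ten2_grading N).1 x.
move: v; apply: addspan_ind => [|v w ev ew|_ [a [m [ax ->]]]].
- by rewrite (addmap0 ten2_homD); exact: subgroup0 sg.
- by rewrite ten2_homD; exact: subgroupD sg ev ew.
by rewrite ten2_homE; exact: tensor_compl_tens.
Qed.

Definition gb_ten2_hom : gb_hom (gb_tens_over_B M) (gb_tens_over_B N) :=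
  @GbHom _ _ _ _ _ (gb_tens_over_B M) (gb_tens_over_B N) (mk_linear ten2_homD ten2_homZ)
    ten2_hom_ract ten2_hom_comp.
End Functor2Map.

Lemma gb_ten2_hom1 (M : lmodType D) :
  gb_ten2_hom (idfun : {linear M -> M}) = gb_id (gb_tens_over_B M).
Proof.
apply: gb_hom_ext; apply: (tensor_ext (g := id)) => //; first exact: ten2_homD.
by move=> t m; exact: ten2_homE.
Qed.

Lemma gb_ten2_homM (M N P : lmodType D) (f : {linear N -> P}) (g : {linear M -> N}) :
  gb_ten2_hom (f \o g : {linear M -> P}) = gb_hcomp (gb_ten2_hom f) (gb_ten2_hom g).
Proof.
apply: gb_hom_ext; apply: (tensor_ext (g := ten2_hom f \o ten2_hom g)) => //.
- exact: ten2_homD.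
- by move=> x y /=; rewrite !ten2_homD.
by move=> t m /=; rewrite [LHS]ten2_homE [X in ten2_hom f X]ten2_homE [RHS]ten2_homE.
Qed.

Definition tens_over_B_functor :
    functor (mod_category D) (graded_bimodule_category A A') :=
  @Functor (mod_category D) (graded_bimodule_category A A')
    gb_tens_over_B gb_ten2_hom gb_ten2_hom1 gb_ten2_homM.

(** [M (x)_B' A'], where [m b' = (1 (x) b') m] *)
Section Functor3.
Variable M : lmodType D.

Definition tens_over_B' := tensor
  (fun (m : M) (b' : comp1_of A') => dt 1%g 1 (sval b') *: m)
  (fun (b' : comp1_of A') (a' : A') => sval b' * a').
HB.instance Definition _ := GRing.Zmodule.on tens_over_B'.

Definition t3 (m : M) (a' : A') : tens_over_B' := tens _ _ m a'.

Lemma t3Dl m n a' : t3 (m + n) a' = t3 m a' + t3 n a'. Proof. exact: tensDl. Qed.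
Lemma t3Dr m a' b' : t3 m (a' + b') = t3 m a' + t3 m b'. Proof. exact: tensDr. Qed.
Lemma t3_bal m b' a' : ga_comp 1%g b' -> t3 (dt 1%g 1 b' *: m) a' = t3 m (b' * a').
Proof. by move=> b1; exact: (@tens_bal _ _ _ _ _ m (exist _ b' b1) a'). Qed.

Lemma ten3_ind (P : tens_over_B' -> Prop) : P 0 ->
  (forall x y, P x -> P y -> P (x + y)) -> (forall m a', P (t3 m a')) ->
  forall x, P x.
Proof. exact: tensor_ind. Qed.

Definition ten3_ract (v : tens_over_B') (y : A') : tens_over_B' :=
  tensor_map _ _ id (fun a' => a' * y) v.

Lemma ten3_ractE y m a' : ten3_ract (t3 m a') y = t3 m (a' * y).
Proof. by apply: tensor_mapE => // [u v|b u]; [exact: mulrDl|rewrite mulrA]. Qed.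
Lemma ten3_ractD y : addmap (ten3_ract^~ y).
Proof. by apply: tensor_mapD => // [u v|b u]; [exact: mulrDl|rewrite mulrA]. Qed.

(** [a_g (m (x) a') = (a_g (x) u'_g^-1) m (x) u'_g a'], summed over [g]. *)
Definition ten3_lactf (x : A) (m : M) (a' : A') : tens_over_B' :=
  \sum_g t3 (dt g x (cp_uV A' g) *: m) (cp_u A' g * a').
Definition ten3_lact (x : A) (v : tens_over_B') : tens_over_B' := tensor_lift (ten3_lactf x) v.

(* the choice of the unit in degree g is irrelevant *)
Lemma t3_unit m a' g v w x : ga_comp g v -> ga_comp g^-1%g w -> w * v = 1 ->
  t3 (dt g x w *: m) (v * a') =
  t3 (dt g x (cp_uV A' g) *: m) (cp_u A' g * a').
Proof.
move=> vg wg wv; have b1 : ga_comp 1%g (v * cp_uV A' g).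
  by rewrite -(mulgV g); apply: ga_compM => //; exact: cp_uV_comp.
have -> : v * a' = (v * cp_uV A' g) * (cp_u A' g * a').
  by rewrite mulrA -[v * _ * _]mulrA cp_uVu mulr1.
rewrite -(t3_bal _ _ b1) scalerA dt_mul1l //; last exact: ga_comp1.
by rewrite mulrA wv !mul1r.
Qed.

Lemma ten3_lactf_bal x : balanced
  (fun (m : M) (b' : comp1_of A') => dt 1%g 1 (sval b') *: m)
  (fun (b' : comp1_of A') (a' : A') => sval b' * a') (ten3_lactf x).
Proof.
split=> [a' m n|m a' b'|m [b b1] a']; rewrite /ten3_lactf.
- by rewrite -big_split; apply: eq_bigr => h _; rewrite scalerDr t3Dl.
- by rewrite -big_split; apply: eq_bigr => h _; rewrite mulrDr t3Dr.
apply: eq_bigr => h _ /=.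
have c1 : ga_comp 1%g (cp_u A' h * b * cp_uV A' h).
  rewrite -(mulgV h) -[X in (X * _)%g]mulg1; apply: ga_compM; last exact: cp_uV_comp.
  by apply: ga_compM => //; exact: cp_u_comp.
have -> : cp_u A' h * (b * a') = (cp_u A' h * b * cp_uV A' h) * (cp_u A' h * a').
  by rewrite !mulrA -[_ * cp_uV A' h * _]mulrA cp_uVu mulr1.
rewrite -(t3_bal _ _ c1) !scalerA dt_mul1l ?dt_mul1r //; try exact: ga_comp1.
by rewrite mulr1 mul1r !mulrA cp_uVu mul1r.
Qed.

Lemma ten3_lactE x m a' : ten3_lact x (t3 m a') = ten3_lactf x m a'.
Proof. exact: tensor_liftE (ten3_lactf_bal x) _ _. Qed.
Lemma ten3_lactD x : addmap (ten3_lact x).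
Proof. exact: tensor_liftD (ten3_lactf_bal x). Qed.

Lemma dt_outl g h a y : ga_comp h a -> g != h -> dt g a y = 0.
Proof.
by move=> ah gh; apply: val_inj; rewrite /= (hc_in _ ah) (negPf gh) /tC tens0l.
Qed.

Lemma ten3_lact_hom x g m a' : ga_comp g x ->
  ten3_lact x (t3 m a') = t3 (dt g x (cp_uV A' g) *: m) (cp_u A' g * a').
Proof.
move=> xg; rewrite ten3_lactE /ten3_lactf (bigD1 g) //= big1 ?addr0 // => k kg.
by rewrite (dt_outl _ xg) // scale0r /t3 tens0l.
Qed.

Lemma ten3_lactDl v x y : ten3_lact (x + y) v = ten3_lact x v + ten3_lact y v.
Proof.
elim/ten3_ind: v => [|v w ev ew|m a'].
- by rewrite !(addmap0 (ten3_lactD _)) addr0.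
- by rewrite !ten3_lactD ev ew addrACA.
rewrite !ten3_lactE /ten3_lactf -big_split; apply: eq_bigr => h _ /=.
by rewrite dtDl scalerDl t3Dl.
Qed.

Lemma ten3_lact1 v : ten3_lact 1 v = v.
Proof.
elim/ten3_ind: v => [|v w ev ew|m a'].
- by rewrite !(addmap0 (ten3_lactD _)).
- by rewrite !ten3_lactD ev ew.
rewrite (ten3_lact_hom _ _ (ga_comp1 A)).
rewrite -(@t3_unit _ _ 1%g 1 1) ?mul1r ?invg1 //; try exact: ga_comp1.
by rewrite dt1 scale1r.
Qed.

Lemma ten3_lactA x y v : ten3_lact x (ten3_lact y v) = ten3_lact (x * y) v.
Proof.
elim/ten3_ind: v => [|v w ev ew|m a'].
- by rewrite !(addmap0 (ten3_lactD _)).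
- by rewrite !ten3_lactD ev ew.
apply: (hom_ext (@ga_grading _ _ A) (f := fun x => ten3_lact x (ten3_lact y (t3 m a')))
  (g := fun x => ten3_lact (x * y) (t3 m a'))).
- by move=> z z'; rewrite ten3_lactDl.
- by move=> z z'; rewrite mulrDl ten3_lactDl.
move=> h {}x xh.
apply: (hom_ext (@ga_grading _ _ A) (f := fun y => ten3_lact x (ten3_lact y (t3 m a')))
  (g := fun y => ten3_lact (x * y) (t3 m a'))).
- by move=> z z'; rewrite ten3_lactDl ten3_lactD.
- by move=> z z'; rewrite mulrDr ten3_lactDl.
move=> k {}y yk; have xy := ga_compM xh yk.
rewrite (ten3_lact_hom _ _ yk) (ten3_lact_hom _ _ xh) (ten3_lact_hom _ _ xy).
have uVh := cp_uV_comp A' h; have uVk := cp_uV_comp A' k.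
rewrite scalerA dtM // -(@t3_unit _ _ _ (cp_u A' h * cp_u A' k) (cp_uV A' k * cp_uV A' h)).
- by rewrite mulrA.
- by apply: ga_compM; exact: cp_u_comp.
- by rewrite invMg; exact: ga_compM.
- by rewrite mulrA -[_ * _ * cp_u A' h]mulrA cp_uVu mulr1 cp_uVu.
Qed.

HB.instance Definition _ := GRing.Zmodule_isLmodule.Build A tens_over_B'
  ten3_lactA ten3_lact1 ten3_lactD ten3_lactDl.

Lemma ten3_scale_hom x g m a' : ga_comp g x ->
  x *: t3 m a' = t3 (dt g x (cp_uV A' g) *: m) (cp_u A' g * a').
Proof. exact: ten3_lact_hom. Qed.

Lemma ten3_ractDr v : addmap (ten3_ract v).
Proof.
move=> y z; elim/ten3_ind: v => [|v w ev ew|m a'].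
- by rewrite !(addmap0 (ten3_ractD _)) addr0.
- by rewrite !ten3_ractD ev ew addrACA.
by rewrite !ten3_ractE mulrDr t3Dr.
Qed.

Lemma ten3_ract1 v : ten3_ract v 1 = v.
Proof.
elim/ten3_ind: v => [|v w ev ew|m a'].
- by rewrite !(addmap0 (ten3_ractD _)).
- by rewrite !ten3_ractD ev ew.
by rewrite ten3_ractE mulr1.
Qed.

Lemma ten3_ractM v y z : ten3_ract v (y * z) = ten3_ract (ten3_ract v y) z.
Proof.
elim/ten3_ind: v => [|v w ev ew|m a'].
- by rewrite !(addmap0 (ten3_ractD _)).
- by rewrite !ten3_ractD ev ew.
by rewrite !ten3_ractE mulrA.
Qed.

Lemma ten3_ractZ x v y : ten3_ract (x *: v) y = x *: ten3_ract v y.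
Proof.
elim/ten3_ind: v => [|v w ev ew|m a'].
- by rewrite scaler0 !(addmap0 (ten3_ractD _)) scaler0.
- by rewrite scalerDr !ten3_ractD scalerDr ev ew.
rewrite ten3_ractE [x *: t3 _ _]ten3_lactE [x *: t3 _ _]ten3_lactE.
rewrite /ten3_lactf (addmap_sum (ten3_ractD y)).
by apply: eq_bigr => h _; rewrite ten3_ractE mulrA.
Qed.

Definition ten3_comp : Gb -> set tens_over_B' := tensor_compr (@ga_comp _ _ A').

Lemma ten3_grading : is_grading ten3_comp.
Proof.
apply: tensor_gradingr; first exact: ga_grading.
  by move=> b x y; exact: mulrDr.
move=> g [b b1] a ag /=; rewrite -[X in ga_comp X _]mul1g; exact: ga_compM.
Qed.

Lemma ten3_compM g x h a v a' : ga_comp g a -> ten3_comp x v -> ga_comp h a' ->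
  ten3_comp (g * x * h)%g (ten3_ract (a *: v) a').
Proof.
move=> ag vx a'h; have sg := ten3_grading.1 (g * x * h)%g.
move: v vx; apply: addspan_ind => [|v w ev ew|_ [m [d [dx ->]]]].
- by rewrite scaler0 (addmap0 (ten3_ractD _)); exact: subgroup0 sg.
- by rewrite scalerDr ten3_ractD; exact: subgroupD sg ev ew.
rewrite (ten3_scale_hom _ _ ag) ten3_ractE.
apply: tensor_compr_tens; apply: ga_compM => //.
by apply: ga_compM => //; exact: cp_u_comp.
Qed.

Lemma ten3_scale_zeta m a' c :
  co_zeta A c *: t3 m a' = t3 m (co_zeta A' c * a').
Proof.
apply: (hom_ext (@ga_grading _ _ C)
  (f := fun c => co_zeta A c *: t3 m a')
  (g := fun c => t3 m (co_zeta A' c * a'))).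
- by move=> x y; rewrite rmorphD scalerDl.
- by move=> x y; rewrite rmorphD mulrDl t3Dr.
move=> k {}c ck; have zc : ga_comp k (co_zeta A c) by exact: co_zeta_comp.
have z'c : ga_comp k (co_zeta A' c) by exact: co_zeta_comp.
have uVk := cp_uV_comp A' k.
have := @dt_bal _ _ _ A A' 1%g k 1 c (cp_uV A' k) (ga_comp1 A) ck.
rewrite mul1g mul1r => /(_ uVk) e.
rewrite (ten3_scale_hom _ _ zc) e t3_bal; last by rewrite -(mulgV k); exact: ga_compM.
by rewrite mulrA -[_ * _ * cp_u A' k]mulrA cp_uVu mulr1.
Qed.

Lemma ten3_over g v c : ten3_comp g v ->
  ten3_ract v (co_zeta A' c) = co_zeta A (gaa_act C g c) *: v.
Proof.
move: v; apply: addspan_ind => [|v w ev ew|_ [m [a [ag ->]]]].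
- by rewrite scaler0 (addmap0 (ten3_ractD _)).
- by rewrite scalerDr ten3_ractD ev ew.
by rewrite ten3_ractE ten3_scale_zeta (co_zetaC _ ag).
Qed.

Definition gb_tens_over_B' : graded_bimodule A A' :=
  @GradedBimodule _ _ _ A A' tens_over_B' ten3_ract ten3_ractD ten3_ractDr ten3_ract1
    ten3_ractM ten3_ractZ ten3_comp ten3_grading ten3_compM ten3_over.
End Functor3.

Section Functor3Map.
Variables (M N : lmodType D) (f : {linear M -> N}).

Definition ten3_hom : tens_over_B' M -> tens_over_B' N := tensor_map _ _ f id.

Lemma ten3_homE m a' : ten3_hom (t3 m a') = t3 (f m) a'.
Proof.
by apply: tensor_mapE => // [u v|b u]; [exact: raddfD|exact: linearZ].
Qed.

Lemma ten3_homD : addmap ten3_hom.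
Proof.
by apply: tensor_mapD => // [u v|b u]; [exact: raddfD|exact: linearZ].
Qed.

Lemma ten3_homZ : scalable ten3_hom.
Proof.
move=> x; elim/ten3_ind => [|v w ev ew|m a'].
- by rewrite scaler0 !(addmap0 ten3_homD) scaler0.
- by rewrite scalerDr !ten3_homD scalerDr ev ew.
rewrite ten3_homE [x *: t3 _ _]ten3_lactE [x *: t3 _ _]ten3_lactE.
rewrite /ten3_lactf (addmap_sum ten3_homD).
by apply: eq_bigr => h _; rewrite ten3_homE linearZ.
Qed.

Lemma ten3_hom_ract v y : ten3_hom (ten3_ract v y) = ten3_ract (ten3_hom v) y.
Proof.
elim/ten3_ind: v => [|v w ev ew|m a'].
- by rewrite (addmap0 (ten3_ractD _)) !(addmap0 ten3_homD) (addmap0 (ten3_ractD _)).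
- by rewrite ten3_ractD !ten3_homD ten3_ractD ev ew.
by rewrite ten3_ractE !ten3_homE ten3_ractE.
Qed.

Lemma ten3_hom_comp x v : ten3_comp x v -> ten3_comp x (ten3_hom v).
Proof.
have sg := (ten3_grading N).1 x.
move: v; apply: addspan_ind => [|v w ev ew|_ [m [a [ax ->]]]].
- by rewrite (addmap0 ten3_homD); exact: subgroup0 sg.
- by rewrite ten3_homD; exact: subgroupD sg ev ew.
by rewrite ten3_homE; exact: tensor_compr_tens.
Qed.

Definition gb_ten3_hom : gb_hom (gb_tens_over_B' M) (gb_tens_over_B' N) :=
  @GbHom _ _ _ _ _ (gb_tens_over_B' M) (gb_tens_over_B' N) (mk_linear ten3_homD ten3_homZ)
    ten3_hom_ract ten3_hom_comp.
End Functor3Map.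

Lemma gb_ten3_hom1 (M : lmodType D) :
  gb_ten3_hom (idfun : {linear M -> M}) = gb_id (gb_tens_over_B' M).
Proof.
apply: gb_hom_ext; apply: (tensor_ext (g := id)) => //; first exact: ten3_homD.
by move=> t m; exact: ten3_homE.
Qed.

Lemma gb_ten3_homM (M N P : lmodType D) (f : {linear N -> P}) (g : {linear M -> N}) :
  gb_ten3_hom (f \o g : {linear M -> P}) = gb_hcomp (gb_ten3_hom f) (gb_ten3_hom g).
Proof.
apply: gb_hom_ext; apply: (tensor_ext (g := ten3_hom f \o ten3_hom g)) => //.
- exact: ten3_homD.
- by move=> x y /=; rewrite !ten3_homD.
by move=> t m /=; rewrite [LHS]ten3_homE [X in ten3_hom f X]ten3_homE [RHS]ten3_homE.
Qed.

Definition tens_over_B'_functor :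
    functor (mod_category D) (graded_bimodule_category A A') :=
  @Functor (mod_category D) (graded_bimodule_category A A')
    gb_tens_over_B' gb_ten3_hom gb_ten3_hom1 gb_ten3_homM.

Section Component.
Variable N : graded_bimodule A A'.

Definition comp1_pred : {pred N} := fun n => `[< gb_comp 1%g n >].

Lemma comp1_zmod_closed : zmod_closed comp1_pred.
Proof.
have sg := (gb_grading N).1 1%g.
split; first by apply/asboolP; exact: subgroup0 sg.
by move=> x y /asboolP x1 /asboolP y1; apply/asboolP; exact: subgroupB sg x1 y1.
Qed.
HB.instance Definition _ := GRing.isZmodClosed.Build N comp1_pred comp1_zmod_closed.

Definition gcomp1 := {n : N | n \in comp1_pred}.
HB.instance Definition _ := SubChoice.on gcomp1.
HB.instance Definition _ := [SubChoice_isSubZmodule of gcomp1 by <:].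

Lemma gcomp1P (n : gcomp1) : gb_comp 1%g (val n).
Proof. by apply/asboolP; exact: valP n. Qed.

Definition mk_gcomp1 (n : N) (n1 : gb_comp 1%g n) : gcomp1 := exist _ n (asboolT n1).

(** [(a (x) a') n = a n a'], well defined for [n] of degree 1. *)
Definition tC_act (t : T) (n : N) : N := tC_lift (fun a a' => gb_ract (a *: n : N) a') t.

Lemma tC_act_bal n : gb_comp 1%g n ->
  tC_balanced (C := C) (fun (a : A) (a' : A') => gb_ract (a *: n : N) a').
Proof.
move=> n1; split=> [a' a b|a a' b'|a c a'].
- by rewrite scalerDl gb_ractDl.
- by rewrite gb_ractDr.
by rewrite gb_ractM (gb_ractZ a) (gb_over _ n1) gaa_act1 scalerA.
Qed.

Lemma tC_actE n a a' : gb_comp 1%g n -> tC_act (tC a a') n = gb_ract (a *: n : N) a'.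
Proof. by move=> n1; exact: tC_liftE (tC_act_bal n1). Qed.
Lemma tC_actDl n : gb_comp 1%g n -> addmap (tC_act^~ n).
Proof. by move=> n1; exact: tC_liftD (tC_act_bal n1). Qed.
Lemma tC_actDr t : addmap (tC_act t).
Proof.
move=> x y; rewrite -big_split; apply: eq_bigr => p _ /=.
by rewrite scalerDr gb_ractDl.
Qed.

Lemma tC_act1 t n : diag_set t -> gb_comp 1%g n -> gb_comp 1%g (tC_act t n).
Proof.
have sg := (gb_grading N).1 1%g.
move=> tD n1; elim/diag_ind: t / tD => [|x y _ _ ex ey|g a a' ag a'g].
- by rewrite (addmap0 (tC_actDl n1)); exact: subgroup0 sg.
- by rewrite (tC_actDl n1); exact: subgroupD sg ex ey.
by rewrite tC_actE // -(mulgV g) -{1}[g]mulg1; exact: gb_compM.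
Qed.

Definition gcomp1_scale (d : D) (n : gcomp1) : gcomp1 :=
  mk_gcomp1 (tC_act1 (diagP d) (gcomp1P n)).

Lemma gcomp1_scaleA d e n :
  gcomp1_scale d (gcomp1_scale e n) = gcomp1_scale (d * e) n.
Proof.
apply: val_inj; have n1 := gcomp1P n.
change (tC_act (val d) (tC_act (val e) (val n)) =
        tC_act (tC_mul (val d) (val e)) (val n)).
move: (val n) n1 (val d) (diagP d) (val e) (diagP e) => {}n n1 {}d dD {}e eD.
have act1 t : diag_set t -> gb_comp 1%g (tC_act t n) by move=> tD; exact: tC_act1.
elim/diag_ind: e / eD => [|x y xD yD ex ey|g a a' ag a'g].
- by rewrite (addmap0 (tC_actDl n1)) (addmap0 (tC_mulDr _)) (addmap0 (tC_actDr _))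
    (addmap0 (tC_actDl n1)).
- by rewrite (tC_actDl n1) tC_actDr tC_mulDr (tC_actDl n1) ex ey.
have eD := diag_tens ag a'g.
elim/diag_ind: d / dD => [|x y xD yD ex ey|h b b' bh b'h].
- by rewrite (addmap0 (tC_actDl (act1 _ eD))) (addmap0 (tC_mulDl eD))
    (addmap0 (tC_actDl n1)).
- by rewrite (tC_actDl (act1 _ eD)) (tC_mulDl eD) (tC_actDl n1) ex ey.
rewrite (tC_mulE _ _ ag a'g) (tC_actE _ _ (act1 _ eD)) !tC_actE //.
by rewrite -gb_ractZ scalerA gb_ractM.
Qed.

Lemma gcomp1_scale1 n : gcomp1_scale 1 n = n.
Proof.
apply: val_inj; rewrite /= tC_actE; last exact: gcomp1P.
by rewrite scale1r gb_ract1.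
Qed.

Lemma gcomp1_scaleDr d : addmap (gcomp1_scale d).
Proof. by move=> x y; apply: val_inj; rewrite /= tC_actDr. Qed.

Lemma gcomp1_scaleDl n d e :
  gcomp1_scale (d + e) n = gcomp1_scale d n + gcomp1_scale e n.
Proof. by apply: val_inj; rewrite /= (tC_actDl (gcomp1P n)). Qed.

HB.instance Definition _ := GRing.Zmodule_isLmodule.Build D gcomp1
  gcomp1_scaleA gcomp1_scale1 gcomp1_scaleDr gcomp1_scaleDl.
End Component.

Section ComponentMap.
Variables (M N : graded_bimodule A A') (f : gb_hom M N).

Definition gcomp1_map (n : gcomp1 M) : gcomp1 N :=
  mk_gcomp1 (gb_fun_comp f (gcomp1P n)).

Lemma gcomp1_mapD : addmap gcomp1_map.
Proof. by move=> x y; apply: val_inj; rewrite /= raddfD. Qed.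

Lemma gcomp1_mapZ : scalable gcomp1_map.
Proof.
move=> d n; apply: val_inj; have n1 := gcomp1P n.
change (f (tC_act (val d) (val n)) = tC_act (val d) (f (val n))).
move: (val n) n1 (val d) => {}n n1 {}d; have fn1 := gb_fun_comp f n1.
elim/tensC_ind: d => [|x y ex ey|a a'].
- by rewrite (addmap0 (tC_actDl n1)) (addmap0 (tC_actDl fn1)) raddf0.
- by rewrite (tC_actDl n1) (tC_actDl fn1) linearD ex ey.
by rewrite !tC_actE // gb_fun_ract linearZ.
Qed.

Definition gcomp1_hom : {linear gcomp1 M -> gcomp1 N} :=
  mk_linear gcomp1_mapD gcomp1_mapZ.
End ComponentMap.

Lemma gcomp1_hom1 (M : graded_bimodule A A') :
  gcomp1_hom (gb_id M) = (idfun : {linear gcomp1 M -> gcomp1 M}).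
Proof. by apply: linear_ext => n; apply: val_inj. Qed.

Lemma gcomp1_homM (M N P : graded_bimodule A A') (f : gb_hom N P) (g : gb_hom M N) :
  gcomp1_hom (gb_hcomp f g) =
  (gcomp1_hom f \o gcomp1_hom g : {linear gcomp1 M -> gcomp1 P}).
Proof. by apply: linear_ext => n; apply: val_inj. Qed.

Definition component1_functor :
    functor (graded_bimodule_category A A') (mod_category D) :=
  @Functor (graded_bimodule_category A A') (mod_category D)
    gcomp1 gcomp1_hom gcomp1_hom1 gcomp1_homM.
End Functors.

(** Complete discrete valuation rings, through a uniformizer [p]: every nonzero
    element is a unit times a power of [p], and every [p]-adically coherent
    sequence converges (separatedness is automatic). *)
Definition is_uniformizer (O : idomainType) (p : O) :=
  [/\ p != 0, p \isn't a GRing.unit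
    & forall x, x != 0 -> exists n u, u \is a GRing.unit /\ x = u * p ^+ n].

Definition adically_complete (O : idomainType) (p : O) :=
  forall x : nat -> O, (forall n, exists y, x n.+1 - x n = p ^+ n * y) ->
  exists l, forall n, exists y, l - x n = p ^+ n * y.

Definition complete_dvr (O : idomainType) :=
  exists2 p : O, is_uniformizer p & adically_complete p.

(* Main.v *)
(** Since [A] is a crossed product, multiplication by [u_g] identifies the
    components of degrees [1] and [g] of a graded bimodule, so a morphism of
    graded bimodules is invertible as soon as it is bijective in degree [1].
    Each of the three functors [F] comes with a natural bijection
    [M -> (F M)_1], sending [m] to [1 (x) m] or [m (x) 1], whose inverse exists
    because the degree-one part of the other tensor factor acts on [M].  The
    multiplication map [F (N_1) -> N] inverts this bijection in degree [1],
    hence is an isomorphism.  As the three functors share the inverse [(-)_1],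
    [F = F ((F' -)_1) = F'] up to natural isomorphism. *)
Require Import Defs.
From mathcomp Require Import all_boot all_algebra all_fingroup.
From mathcomp Require Import boolp.

Set Implicit Arguments.
Unset Strict Implicit.
Unset Printing Implicit Defensive.

Import GRing.Theory.

Local Open Scope ring_scope.

(** * Natural isomorphisms and uniqueness of inverse equivalences *)

Lemma is_iso_comp (X : category) (U V W : X) (f : chom V W) (g : chom U V) :
  is_iso f -> is_iso g -> is_iso (ccomp f g).
Proof.
move=> [f' [f'f ff']] [g' [g'g gg']]; exists (ccomp g' f'); split.
  by rewrite -ccompA (ccompA f' f g) f'f ccomp1f.
by rewrite -ccompA (ccompA g g' f') gg' ccomp1f.
Qed.

Lemma is_iso_fhom (X Y : category) (F : functor X Y) (U V : X) (f : chom U V) :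
  is_iso f -> is_iso (fhom F f).
Proof.
by move=> [f' [f'f ff']]; exists (fhom F f'); rewrite -!fhomM f'f ff' !fhom1.
Qed.

Lemma nat_isomorphic_sym (X Y : category) (F G : functor X Y) :
  nat_isomorphic F G -> nat_isomorphic G F.
Proof.
move=> [a [aI aN]]; pose b U := projT1 (cid (aI U)).
have bP U : ccomp (b U) (a U) = idmor _ /\ ccomp (a U) (b U) = idmor _.
  exact: projT2 (cid (aI U)).
exists b; split=> [U|U V f]; first by exists (a U); have [] := bP U.
(* Inserting [a U] after [b U] on the right allows the naturality of [a] to be used; [b V] then
   cancels [a V]. *)
rewrite -[LHS]ccompf1 -(bP U).2 -ccompA (ccompA _ (a U)) -aN.
by rewrite 2!ccompA (bP V).1 ccomp1f.
Qed.

Lemma nat_isomorphic_trans (X Y : category) (F G H : functor X Y) :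
  nat_isomorphic F G -> nat_isomorphic G H -> nat_isomorphic F H.
Proof.
move=> [a [aI aN]] [b [bI bN]]; exists (fun U => ccomp (b U) (a U)).
split=> [U|U V f]; first exact: is_iso_comp.
by rewrite -ccompA aN !ccompA bN.
Qed.

Lemma nat_isomorphic_compl (X Y Z : category) (H : functor Y Z)
    (F G : functor X Y) :
  nat_isomorphic F G -> nat_isomorphic (comp_functor H F) (comp_functor H G).
Proof.
move=> [a [aI aN]]; exists (fun U => fhom H (a U)).
split=> [U|U V f]; first exact: (is_iso_fhom H (aI U)).
by rewrite /= -!fhomM aN.
Qed.

Lemma nat_isomorphic_compr (X Y Z : category) (H : functor X Y)
    (F G : functor Y Z) :
  nat_isomorphic F G -> nat_isomorphic (comp_functor F H) (comp_functor G H).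
Proof.
move=> [a [aI aN]]; exists (fun U => a (H U)).
by split=> [U|U V f]; [exact: aI|exact: aN].
Qed.

(** The chain is [F = F 1], isomorphic to [F (G F') = (F G) F'], isomorphic to [1 F' = F']. The
    equalities hold by conversion, since [nat_isomorphic] only sees the object and morphism maps of
    its functors. *)
Lemma inverse_equivalences_uniq (X Y : category) (F F' : functor X Y)
    (G : functor Y X) :
  inverse_equivalences F G -> inverse_equivalences F' G -> nat_isomorphic F F'.
Proof.
move=> [_ FG] [GF' _]; apply: (@nat_isomorphic_trans _ _ _
  (comp_functor F (comp_functor G F'))).
  exact: (nat_isomorphic_sym (nat_isomorphic_compl F GF')).
exact: (nat_isomorphic_compr F' FG).
Qed.

(** * Bijective linear maps are isomorphisms *)

Lemma addmap_inj (V W : zmodType) (f : V -> W) : addmap f ->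
  (forall v, f v = 0 -> v = 0) -> injective f.
Proof.
by move=> fD f0 v w e; apply/eqP; rewrite -subr_eq0; apply/eqP/f0;
  rewrite addmapB // e subrr.
Qed.

(** A set-theoretic section of [f], obtained by choice, is linear because [f] is linear and
    injective. *)
Lemma mod_is_iso (R : pzRingType) (U V : lmodType R) (f : {linear U -> V}) :
  injective f -> (forall v, exists u, f u = v) -> is_iso (X := mod_category R) f.
Proof.
move=> fI /choice[g fg].
have gD : addmap g by move=> x y; apply: fI; rewrite linearD !fg.
have gZ : scalable g by move=> k x; apply: fI; rewrite linearZ !fg.
exists (mk_linear gD gZ); split; apply: linear_ext => x /=; last exact: fg.
by apply: fI; rewrite fg.
Qed.

(** * Isomorphisms of graded bimodules, detected in degree 1 *)

Section OneComponent.
Variables (O : comPzRingType) (Gb : finGroupType).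
Variable C : graded_acted_algebra O Gb.
Variables A A' : crossed_product_over C.

Notation T := (tensC A A').
Notation D := (diag A A').
Notation dt := (@dt O Gb C A A').
Notation Gr := (graded_bimodule_category A A').

(** Beyond linearity, the inverse must preserve degrees. This follows because [f] commutes with
    taking homogeneous components: if [n] has degree [x], then [g n] and its component of degree [x]
    have the same image under [f]. *)
Lemma gb_is_iso (M N : graded_bimodule A A') (f : gb_hom M N) :
  injective f -> (forall n, exists m, f m = n) -> is_iso (X := Gr) f.
Proof.
move=> fI /choice[g fg].
have gD : addmap g by move=> x y; apply: fI; rewrite linearD !fg.
have gZ : scalable g by move=> k x; apply: fI; rewrite linearZ !fg.
have gr m y : g (gb_ract m y) = gb_ract (g m) y.
  by apply: fI; rewrite gb_fun_ract !fg.
have fh x m : f (hcomp (@gb_comp _ _ _ _ _ M) x m) =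
              hcomp (@gb_comp _ _ _ _ _ N) x (f m).
  apply/esym; apply: (hcomp_uniq (gb_grading N)
    (f := fun i => f (hcomp (@gb_comp _ _ _ _ _ M) i m))).
    by move=> i; apply: gb_fun_comp; exact: hcompP (gb_grading M) _ _.
  by rewrite -linear_sum (hcomp_sum (gb_grading M)).
have gc x n : gb_comp x n -> gb_comp x (g n).
  move=> nx; have -> : g n = hcomp (@gb_comp _ _ _ _ _ M) x (g n).
    by apply: fI; rewrite fh fg (hcomp_id (gb_grading N) nx).
  exact: hcompP (gb_grading M) _ _.
exists (@GbHom _ _ _ _ _ N M (mk_linear gD gZ) gr gc).
split; apply: gb_hom_ext => x /=; last exact: fg.
by apply: fI; rewrite fg.
Qed.

Lemma gb_comp_scale (M : graded_bimodule A A') g x a (m : M) :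
  ga_comp g a -> gb_comp x m -> gb_comp (g * x)%g (a *: m).
Proof.
move=> ag mx; rewrite -[(g * x)%g]mulg1 -[_ *: m]gb_ract1.
by apply: gb_compM => //; exact: ga_comp1.
Qed.

(** The kernel and the image of [f] are compatible with the gradings and stable under the units, so
    both can be tested after moving degree [g] to degree 1 by [u_g^-1]. *)
Lemma gb_is_iso_comp1 (M N : graded_bimodule A A') (f : gb_hom M N) :
  (forall m, gb_comp 1%g m -> f m = 0 -> m = 0) ->
  (forall n, gb_comp 1%g n -> exists m, f m = n) -> is_iso (X := Gr) f.
Proof.
move=> f1I f1S; have gM := gb_grading M; have gN := gb_grading N.
have shift (L : graded_bimodule A A') g (m : L) :
    gb_comp g m -> gb_comp 1%g (cp_uV A g *: m).
  by move=> mg; rewrite -(mulVg g); apply: gb_comp_scale; first exact: cp_uV_comp.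
apply: gb_is_iso => [|n].
  apply: addmap_inj => [x y|m fm0]; first exact: linearD.
  have fmg g : f (hcomp (@gb_comp _ _ _ _ _ M) g m) = 0.
    apply/esym; rewrite -(addmap0 (hcompD gN g)).
    apply: (hcomp_uniq gN (f := fun g => f (hcomp (@gb_comp _ _ _ _ _ M) g m))).
      by move=> i; apply: gb_fun_comp; exact: hcompP.
    by rewrite -linear_sum (hcomp_sum gM) fm0.
  rewrite -(hcomp_sum gM m); apply: big1 => g _; set mg := hcomp _ _ _.
  (* Here [mg = u_g (u_g^-1 mg)], where the inner factor has degree 1 and is killed by [f]. *)
  rewrite -[mg]scale1r -(cp_uuV A g) -scalerA (f1I (cp_uV A g *: mg)) ?scaler0 //.
    by apply: shift; exact: hcompP.
  by rewrite linearZ /= fmg scaler0.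
move: n; apply: (Defs.hom_ind gN) => [|x y [m <-] [m' <-]|g n ng].
- by exists 0; rewrite linear0.
- by exists (m + m'); rewrite linearD.
(* A preimage of [u_g^-1 n], which has degree 1, is carried back by [u_g]. *)
have [m fm] := f1S _ (shift _ _ _ ng).
by exists (cp_u A g *: m); rewrite linearZ /= fm scalerA cp_uuV scale1r.
Qed.

(** * A criterion for a functor to be inverse to the 1-component *)

Section Criterion.
Variable F : functor (mod_category D) Gr.
Variable eta : forall M : lmodType D, {linear M -> gcomp1 (F M : graded_bimodule A A')}.
Variable eps : forall N : graded_bimodule A A', gb_hom (F (gcomp1 N)) N.

Hypothesis eta_inj : forall M, injective (@eta M).
Hypothesis eta_surj : forall M v, exists m, @eta M m = v.
Hypothesis eta_nat : forall (M M' : lmodType D) (f : {linear M -> M'}) m,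
  (fhom F (f : chom (c := mod_category D) M M') : gb_hom _ _) (val (eta M m)) =
  val (eta M' (f m)).
Hypothesis eps_nat : forall (N N' : graded_bimodule A A') (f : gb_hom N N'),
  forall v, eps N' ((fhom F (gcomp1_hom f : chom (c := mod_category D) _ _) :
                       gb_hom _ _) v) = f (eps N v).
Hypothesis eps_eta : forall (N : graded_bimodule A A') (n : gcomp1 N),
  eps N (val (eta (gcomp1 N) n)) = val n.

(** Hypothesis [eps_eta] is a triangle identity: on the 1-component, [eps N] undoes
    [eta (gcomp1 N)]. As the latter is bijective, [eps N] is bijective in degree 1, hence an
    isomorphism. *)
Lemma inverse_equivalences_comp1 :
  inverse_equivalences F (component1_functor A A').
Proof.
split.
  (* The map [eta] goes from the identity to the composite, opposite to the required direction. *)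
  apply: nat_isomorphic_sym.
  exists (fun M : lmodType D => eta M); split=> [M|M M' f].
    by apply: mod_is_iso; [exact: eta_inj|exact: eta_surj].
  by apply: linear_ext => m; apply: val_inj; rewrite /= -eta_nat.
exists (fun N : graded_bimodule A A' => eps N); split=> [N|N N' f].
  apply: gb_is_iso_comp1 => [v v1 v0|n n1].
    have [n en] := eta_surj (mk_gcomp1 v1).
    have ve : v = val (eta _ n) by rewrite en.
    move: v0; rewrite {}ve eps_eta => n0.
    have -> : n = 0 by apply: val_inj.
    by rewrite linear0.
  by exists (val (eta _ (mk_gcomp1 n1))); rewrite eps_eta.
by apply: gb_hom_ext => v; exact: eps_nat.
Qed.
End Criterion.

(** * The diagonal algebra and its action on 1-components *)

Lemma dt_ind (P : D -> Prop) : P 0 -> (forall d e, P d -> P e -> P (d + e)) ->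
  (forall g a a', ga_comp g a -> ga_comp g^-1%g a' -> P (dt g a a')) ->
  forall d, P d.
Proof.
move=> P0 PD Pdt d; have -> : d = mk_diag (diagP d) by apply: val_inj.
(* The membership proof carried by an element of [D] is generalised, so that the induction
   hypotheses apply to the summands with any such proof. *)
elim/diag_ind: {d}(val d) / (diagP d) (diagP d) =>
  [|x y xD yD Px Py|g a a' ag a'g] tD.
- by have -> : mk_diag tD = 0 by apply: val_inj.
- have -> : mk_diag tD = mk_diag xD + mk_diag yD by apply: val_inj.
  exact: PD.
have -> : mk_diag tD = dt g a a' by apply: val_inj; rewrite val_dt.
exact: Pdt.
Qed.

Section ToComponent.
Variables (M : lmodType D) (N : graded_bimodule A A') (f : M -> N).
Hypotheses (fD : addmap f) (f1 : forall m, gb_comp 1%g (f m)).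
Hypothesis f_dt : forall g (a : A) (a' : A') m, ga_comp g a -> ga_comp g^-1%g a' ->
  gb_ract (a *: f m : N) a' = f (dt g a a' *: m).

Lemma to_gcomp1D : addmap (fun m => mk_gcomp1 (f1 m)).
Proof. by move=> x y; apply: val_inj; rewrite /= fD. Qed.

(** The elements [dt g a a'] with homogeneous [a], [a'] span [D], so [f_dt] suffices. The three maps
    [M -> (F M)_1] below are all built in this way. *)
Lemma to_gcomp1Z : scalable (fun m => mk_gcomp1 (f1 m)).
Proof.
move=> d m; elim/dt_ind: d => [|d e ed ee|g a a' ag a'g].
- by rewrite !scale0r (addmap0 to_gcomp1D).
- by rewrite !scalerDl to_gcomp1D ed ee.
by apply: val_inj; rewrite /= !hc_id // tC_actE // (f_dt _ ag a'g).
Qed.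

Definition to_gcomp1 : {linear M -> gcomp1 N} := mk_linear to_gcomp1D to_gcomp1Z.
End ToComponent.

Section DiagonalAction.
Variable N : graded_bimodule A A'.
Implicit Types (n : N) (t : T).

(** As [s] is diagonal, [s n] stays in degree 1, where the action of any [t] is well defined. On
    pure tensors both sides are [a d n d' a']. Allowing [t] outside the diagonal gives the
    balancedness of the counit for the first functor. *)
Lemma tC_act_mul t s n : diag_set s -> gb_comp 1%g n ->
  tC_act (tC_mul t s) n = tC_act t (tC_act s n).
Proof.
move=> sD n1; elim/diag_ind: s / sD => [|x y xD yD ex ey|g d d' dg d'g].
- by rewrite (addmap0 (tC_mulDr _)) !(addmap0 (tC_actDl n1)) (addmap0 (tC_actDr _)).
- by rewrite tC_mulDr !(tC_actDl n1) tC_actDr ex ey.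
have sD := diag_tens dg d'g; have sn1 := tC_act1 sD n1.
elim/tensC_ind: t => [|x y ex ey|a a'].
- by rewrite (addmap0 (tC_mulDl sD)) (addmap0 (tC_actDl n1)) (addmap0 (tC_actDl sn1)).
- by rewrite (tC_mulDl sD) (tC_actDl n1) (tC_actDl sn1) ex ey.
rewrite (tC_mulE _ _ dg d'g) (tC_actE _ _ sn1) !tC_actE //.
by rewrite -gb_ractZ scalerA gb_ractM.
Qed.

Lemma tC_act_scale x t n : gb_comp 1%g n -> tC_act (x *: t) n = x *: tC_act t n.
Proof.
move=> n1; elim/tensC_ind: t => [|t s et es|a a'].
- by rewrite scaler0 !(addmap0 (tC_actDl n1)) scaler0.
- by rewrite scalerDr !(tC_actDl n1) et es scalerDr.
by rewrite tC_scaleE !tC_actE // -gb_ractZ scalerA.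
Qed.

Lemma tC_act_ract t y n : gb_comp 1%g n ->
  tC_act (tC_ract t y) n = gb_ract (tC_act t n) y.
Proof.
move=> n1; elim/tensC_ind: t => [|t s et es|a a'].
- by rewrite (addmap0 (tC_ractD _)) !(addmap0 (tC_actDl n1)) (addmap0 (gb_ractDl _)).
- by rewrite tC_ractD !(tC_actDl n1) et es gb_ractDl.
by rewrite tC_ractE !tC_actE // gb_ractM.
Qed.

Lemma tC_act_comp x t n : tC_comp x t -> gb_comp 1%g n -> gb_comp x (tC_act t n).
Proof.
have sg := (gb_grading N).1 x.
move=> + n1; move: t; apply: addspan_ind => [|t s et es|_ [g [h [a [a' [<- ag a'h ->]]]]]].
- by rewrite (addmap0 (tC_actDl n1)); exact: subgroup0 sg.
- by rewrite (tC_actDl n1); exact: subgroupD sg et es.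
by rewrite tC_actE // -[g in (g * h)%g]mulg1; exact: gb_compM.
Qed.
End DiagonalAction.

Lemma val_dt_scale (N : graded_bimodule A A') g (a : A) (a' : A') (n : gcomp1 N) :
  ga_comp g a -> ga_comp g^-1%g a' ->
  val (dt g a a' *: n) = gb_ract (a *: val n) a'.
Proof.
move=> ag a'g; change (tC_act (val (dt g a a')) (val n) = gb_ract (a *: val n) a').
by rewrite val_dt // tC_actE //; exact: gcomp1P.
Qed.

(** * The functor given by tensoring over the diagonal algebra *)

Section TensorOverDiagonal.

(** A generator of degree [g h = 1] has [h = g^-1]. Hence the projection to degree 1 takes values in
    [D]. *)
Lemma tC_comp1_diag (t : T) : tC_comp 1%g t -> diag_set t.
Proof.
move: t; apply: addspan_ind => [|t s|_ [g [h [a [a' [gh ag a'h ->]]]]]].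
- exact: subgroup0 (diag_sg _ _).
- exact: subgroupD (diag_sg _ _).
apply: (diag_tens ag); suff -> : (g^-1 = h)%g by [].
by rewrite -[h](mulKg g) gh mulg1.
Qed.

Definition diag_proj (t : T) : D := mk_diag (tC_comp1_diag (tC_compP 1%g t)).

Lemma diag_projD : addmap diag_proj.
Proof. by move=> x y; apply: val_inj; exact: tC_projD. Qed.

(** Right multiplication by a diagonal element preserves degrees, so it commutes with the projection
    to degree 1. *)
Lemma diag_projM t (d : D) : diag_proj (tC_mul t (val d)) = diag_proj t * d.
Proof.
have dD := diagP d; apply: val_inj; rewrite val_diagM /=.
apply: (hom_ext (tC_grading A A') (f := fun t => tC_proj 1%g (tC_mul t (val d)))
  (g := fun t => tC_mul (tC_proj 1%g t) (val d))) t.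
- by move=> x y; rewrite (tC_mulDl dD) tC_projD.
- by move=> x y; rewrite tC_projD (tC_mulDl dD).
move=> x t tx; rewrite (tC_proj_in _ tx) (tC_proj_in _ (tC_comp_mul dD tx)).
by case: ifP => // _; rewrite (addmap0 (tC_mulDl dD)).
Qed.

Lemma diag_proj_id t : tC_comp 1%g t -> val (diag_proj t) = t.
Proof. by move=> t1; rewrite /= (tC_proj_in _ t1) eqxx. Qed.

Section Unit.
Variable M : lmodType D.

Definition eta1_fun (m : M) : tens_over_diag M := t1 (tC 1 1) m.

Lemma tC11_comp : tC_comp 1%g (tC 1 1 : T).
Proof. by rewrite -(mulg1 1%g); apply: tC_comp_tens; exact: ga_comp1. Qed.

Lemma eta1_funD : addmap eta1_fun.
Proof. by move=> m n; exact: tensDr. Qed.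

Lemma eta1_fun_comp m : gb_comp (g0 := gb_tens_over_diag M) 1%g (eta1_fun m).
Proof. exact: tensor_compl_tens tC11_comp. Qed.

(** Write [t = (1 (x) 1) t] and move [t] across the tensor sign. *)
Lemma t1_diag (t : T) (tD : diag_set t) m : t1 t m = eta1_fun (mk_diag tD *: m).
Proof. by rewrite -[t in LHS](tC_mul1r tD); exact: (tens_bal _ _ (tC 1 1) (mk_diag tD)). Qed.

Lemma eta1_fun_dt g (a : A) (a' : A') m : ga_comp g a -> ga_comp g^-1%g a' ->
  gb_ract (g0 := gb_tens_over_diag M) (a *: eta1_fun m) a' = eta1_fun (dt g a a' *: m).
Proof.
move=> ag a'g; rewrite /= ten1_scaleE ten1_ractE tC_scaleE tC_ractE mulr1 mul1r.
rewrite (t1_diag (diag_tens ag a'g)); congr (eta1_fun (_ *: _)).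
by apply: val_inj; rewrite val_dt.
Qed.

Definition eta1 : {linear M -> gcomp1 (gb_tens_over_diag M)} :=
  to_gcomp1 (N := gb_tens_over_diag M) eta1_funD eta1_fun_comp eta1_fun_dt.

(** A retraction is [t (x) m |-> t_1 m], with [t_1] the degree 1 part of [t]; it is balanced by
    [diag_projM]. *)
Lemma eta1_inj : injective eta1.
Proof.
pose r : tens_over_diag M -> M := tensor_lift (fun t m => diag_proj t *: m).
suff rE m : r (eta1_fun m) = m by move=> m n [/(congr1 r)]; rewrite !rE.
rewrite /r tensor_liftE.
  have -> : diag_proj (tC 1 1) = 1; last by rewrite scale1r.
  by apply: val_inj; rewrite diag_proj_id //; exact: tC11_comp.
split=> [n x y|t x y|t d n].
- by rewrite diag_projD scalerDl.
- by rewrite scalerDr.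
by rewrite diag_projM scalerA.
Qed.

(** In a generator [t (x) m] of degree 1 the factor [t] lies in [D], so it can be absorbed into
    [m]. *)
Lemma eta1_surj v : exists m, eta1 m = v.
Proof.
suff [m em] : exists m, eta1_fun m = val v by exists m; apply: val_inj.
move: (val v) (gcomp1P v); apply: addspan_ind.
- by exists 0; exact: addmap0 eta1_funD.
- by move=> _ _ [m <-] [n <-]; exists (m + n); exact: eta1_funD.
move=> _ [t [m [tc ->]]]; exists (mk_diag (tC_comp1_diag tc) *: m).
by rewrite -t1_diag.
Qed.
End Unit.

Section Counit.
Variable N : graded_bimodule A A'.

Definition eps1_fun : tens_over_diag (gcomp1 N) -> N :=
  tensor_lift (fun t n => tC_act t (val n)).

Lemma eps1_balanced : balanced (fun (t : T) (d : D) => tC_mul t (val d))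
  (fun (d : D) (n : gcomp1 N) => d *: n) (fun t n => tC_act t (val n)).
Proof.
split=> [n x y|t x y|t d n].
- exact: (tC_actDl (gcomp1P n)).
- exact: tC_actDr.
exact: (tC_act_mul _ (diagP d) (gcomp1P n)).
Qed.

Lemma eps1_funE t n : eps1_fun (t1 t n) = tC_act t (val n).
Proof. exact: tensor_liftE eps1_balanced _ _. Qed.
Lemma eps1_funD : addmap eps1_fun.
Proof. exact: tensor_liftD eps1_balanced. Qed.

Lemma eps1_funZ : scalable eps1_fun.
Proof.
move=> x; elim/ten1_ind => [|v w ev ew|t n].
- by rewrite scaler0 (addmap0 eps1_funD) scaler0.
- by rewrite scalerDr !eps1_funD ev ew scalerDr.
by rewrite ten1_scaleE !eps1_funE tC_act_scale //; exact: gcomp1P.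
Qed.

Lemma eps1_fun_ract v y : eps1_fun (ten1_ract v y) = gb_ract (eps1_fun v) y.
Proof.
elim/ten1_ind: v => [|v w ev ew|t n].
- by rewrite (addmap0 (ten1_ractD _)) (addmap0 eps1_funD) (addmap0 (gb_ractDl _)).
- by rewrite ten1_ractD !eps1_funD ev ew gb_ractDl.
by rewrite ten1_ractE !eps1_funE tC_act_ract //; exact: gcomp1P.
Qed.

Lemma eps1_fun_comp x v : ten1_comp x v -> gb_comp x (eps1_fun v).
Proof.
have sg := (gb_grading N).1 x.
move: v; apply: addspan_ind => [|v w ev ew|_ [t [n [tx ->]]]].
- by rewrite (addmap0 eps1_funD); exact: subgroup0 sg.
- by rewrite eps1_funD; exact: subgroupD sg ev ew.
by rewrite [X in gb_comp x X]eps1_funE; exact: tC_act_comp (gcomp1P n).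
Qed.

Definition eps1 : gb_hom (gb_tens_over_diag (gcomp1 N)) N :=
  @GbHom _ _ _ _ _ (gb_tens_over_diag (gcomp1 N)) N (mk_linear eps1_funD eps1_funZ)
    eps1_fun_ract eps1_fun_comp.
End Counit.

Lemma tens_over_diag_inverse :
  inverse_equivalences (tens_over_diag_functor A A') (component1_functor A A').
Proof.
apply: (@inverse_equivalences_comp1 (tens_over_diag_functor A A') eta1 eps1).
- exact: eta1_inj.
- exact: eta1_surj.
- by move=> M M' f m; exact: ten1_homE.
- move=> N N' f; apply: tensor_ext => [x y|x y|t n].
  + by rewrite /= ten1_homD eps1_funD.
  + by rewrite /= eps1_funD linearD.
  rewrite /= [ten1_hom _ _]ten1_homE [LHS]eps1_funE [eps1_fun _]eps1_funE.
  have n1 := gcomp1P n; have fn1 := gb_fun_comp f n1.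
  (* On pure tensors, naturality says [f (a n a') = a (f n) a']. *)
  elim/tensC_ind: t => [|x y ex ey|a a'].
  + by rewrite (addmap0 (tC_actDl fn1)) (addmap0 (tC_actDl n1)) linear0.
  + by rewrite (tC_actDl fn1) (tC_actDl n1) linearD ex ey.
  by rewrite !tC_actE // gb_fun_ract linearZ.
move=> N n; rewrite /= [LHS]eps1_funE tC_actE; last exact: gcomp1P.
by rewrite scale1r gb_ract1.
Qed.
End TensorOverDiagonal.

(** * The functor given by tensoring with [A] over [B] *)

Section TensorOverB.

Section Unit.
Variable M : lmodType D.

Definition eta2_fun (m : M) : tens_over_B M := t2 1 m.

Lemma eta2_funD : addmap eta2_fun.
Proof. exact: t2Dr. Qed.

Lemma eta2_fun_comp m : gb_comp (g0 := gb_tens_over_B M) 1%g (eta2_fun m).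
Proof. by apply: tensor_compl_tens; exact: ga_comp1. Qed.

Lemma t2_comp1 (b : A) m : ga_comp 1%g b -> t2 b m = eta2_fun (dt 1%g b 1 *: m).
Proof. by move=> b1; rewrite -[b in LHS]mul1r t2_bal. Qed.

(** With [u] the unit of degree [g^-1], the left side is [a u (x) (u^-1 (x) a') m]. Since [a u] lies
    in [B], it crosses the tensor sign and its [u] cancels. *)
Lemma eta2_fun_dt g (a : A) (a' : A') m : ga_comp g a -> ga_comp g^-1%g a' ->
  gb_ract (g0 := gb_tens_over_B M) (a *: eta2_fun m) a' = eta2_fun (dt g a a' *: m).
Proof.
move=> ag a'g; rewrite /= ten2_scaleE (ten2_ract_hom _ _ a'g) mulr1 invgK.
have b1 : ga_comp 1%g (a * cp_u A g^-1%g).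
  by rewrite -(mulgV g); apply: ga_compM => //; exact: cp_u_comp.
rewrite t2_comp1 // scalerA dt_mul1l //; last exact: ga_comp1.
by rewrite -mulrA cp_uuV !mulr1.
Qed.

Definition eta2 : {linear M -> gcomp1 (gb_tens_over_B M)} :=
  to_gcomp1 (N := gb_tens_over_B M) eta2_funD eta2_fun_comp eta2_fun_dt.

(** A retraction is [a (x) m |-> (a_1 (x) 1) m]: the element [dt 1 a 1] only involves the degree 1
    component of [a], and [a |-> a_1] is right [B]-linear. *)
Lemma eta2_inj : injective eta2.
Proof.
pose r : tens_over_B M -> M := tensor_lift (fun (a : A) m => dt 1%g a 1 *: m).
suff rE m : r (eta2_fun m) = m by move=> m n [/(congr1 r)]; rewrite !rE.
rewrite /r tensor_liftE; first by rewrite dt1 scale1r.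
split=> [n x y|a x y|a [b b1] n].
- by rewrite dtDl scalerDl.
- by rewrite scalerDr.
by rewrite scalerA dt_mul1r ?mulr1 //; exact: ga_comp1.
Qed.

Lemma eta2_surj v : exists m, eta2 m = v.
Proof.
suff [m em] : exists m, eta2_fun m = val v by exists m; apply: val_inj.
move: (val v) (gcomp1P v); apply: addspan_ind.
- by exists 0; exact: addmap0 eta2_funD.
- by move=> _ _ [m <-] [n <-]; exists (m + n); exact: eta2_funD.
move=> _ [b [m [b1 ->]]]; exists (dt 1%g b 1 *: m).
by rewrite -t2_comp1.
Qed.
End Unit.

Section Counit.
Variable N : graded_bimodule A A'.

Definition eps2_fun : tens_over_B (gcomp1 N) -> N :=
  tensor_lift (fun (a : A) n => a *: val n).

Lemma eps2_balanced : balanced (fun (a : A) (b : comp1_of A) => a * sval b)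
  (fun (b : comp1_of A) (n : gcomp1 N) => dt 1%g (sval b) 1 *: n)
  (fun (a : A) n => a *: val n).
Proof.
split=> [n x y|a x y|a [b b1] n].
- exact: scalerDl.
- exact: scalerDr.
by rewrite val_dt_scale ?invg1 //; [rewrite gb_ract1 scalerA|exact: ga_comp1].
Qed.

Lemma eps2_funE a n : eps2_fun (t2 a n) = a *: val n.
Proof. exact: tensor_liftE eps2_balanced _ _. Qed.
Lemma eps2_funD : addmap eps2_fun.
Proof. exact: tensor_liftD eps2_balanced. Qed.

Lemma eps2_funZ : scalable eps2_fun.
Proof.
move=> x; elim/ten2_ind => [|v w ev ew|a n].
- by rewrite scaler0 (addmap0 eps2_funD) scaler0.
- by rewrite scalerDr !eps2_funD ev ew scalerDr.
by rewrite ten2_scaleE !eps2_funE scalerA.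
Qed.

(** The right action is defined through the units, so [y] is first taken homogeneous of degree [h];
    then [(a u_h) (u_h^-1 n y) = a n y]. *)
Lemma eps2_fun_ract v y : eps2_fun (ten2_ract v y) = gb_ract (eps2_fun v) y.
Proof.
elim/ten2_ind: v => [|v w ev ew|a n].
- by rewrite (addmap0 (ten2_ractD _)) (addmap0 eps2_funD) (addmap0 (gb_ractDl _)).
- by rewrite ten2_ractD !eps2_funD ev ew gb_ractDl.
apply: (hom_ext (@ga_grading _ _ A') (f := fun y => eps2_fun (ten2_ract (t2 a n) y))
  (g := fun y => gb_ract (eps2_fun (t2 a n)) y)).
- by move=> x z; rewrite ten2_ractDr eps2_funD.
- exact: gb_ractDr.
move=> h {}y yh; rewrite (ten2_ract_hom _ _ yh) !eps2_funE val_dt_scale.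
- by rewrite -gb_ractZ scalerA -mulrA cp_uuV mulr1.
- exact: cp_uV_comp.
by rewrite invgK.
Qed.

Lemma eps2_fun_comp x v : ten2_comp x v -> gb_comp x (eps2_fun v).
Proof.
have sg := (gb_grading N).1 x.
move: v; apply: addspan_ind => [|v w ev ew|_ [a [n [ax ->]]]].
- by rewrite (addmap0 eps2_funD); exact: subgroup0 sg.
- by rewrite eps2_funD; exact: subgroupD sg ev ew.
by rewrite [X in gb_comp x X]eps2_funE -[x]mulg1;
  apply: gb_comp_scale (gcomp1P n).
Qed.

Definition eps2 : gb_hom (gb_tens_over_B (gcomp1 N)) N :=
  @GbHom _ _ _ _ _ (gb_tens_over_B (gcomp1 N)) N (mk_linear eps2_funD eps2_funZ)
    eps2_fun_ract eps2_fun_comp.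
End Counit.

Lemma tens_over_B_inverse :
  inverse_equivalences (tens_over_B_functor A A') (component1_functor A A').
Proof.
apply: (@inverse_equivalences_comp1 (tens_over_B_functor A A') eta2 eps2).
- exact: eta2_inj.
- exact: eta2_surj.
- by move=> M M' f m; exact: ten2_homE.
- move=> N N' f; apply: tensor_ext => [x y|x y|a n].
  + by rewrite /= ten2_homD eps2_funD.
  + by rewrite /= eps2_funD linearD.
  by rewrite /= [ten2_hom _ _]ten2_homE [LHS]eps2_funE [eps2_fun _]eps2_funE linearZ.
by move=> N n; rewrite /= [LHS]eps2_funE scale1r.
Qed.
End TensorOverB.

(** * The functor given by tensoring with [A'] over [B'] *)

Section TensorOverB'.

Section Unit.
Variable M : lmodType D.

Definition eta3_fun (m : M) : tens_over_B' M := t3 m 1.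

Lemma eta3_funD : addmap eta3_fun.
Proof. by move=> m n; exact: t3Dl. Qed.

Lemma eta3_fun_comp m : gb_comp (g0 := gb_tens_over_B' M) 1%g (eta3_fun m).
Proof. by apply: tensor_compr_tens; exact: ga_comp1. Qed.

Lemma t3_comp1 (b : A') m : ga_comp 1%g b -> t3 m b = eta3_fun (dt 1%g 1 b *: m).
Proof. by move=> b1; rewrite /eta3_fun t3_bal // mulr1. Qed.

(** The left side is [(a (x) u'_g^-1) m (x) u'_g a']. Since [u'_g a'] lies in [B'], it crosses the
    tensor sign and its [u'_g] cancels. *)
Lemma eta3_fun_dt g (a : A) (a' : A') m : ga_comp g a -> ga_comp g^-1%g a' ->
  gb_ract (g0 := gb_tens_over_B' M) (a *: eta3_fun m) a' = eta3_fun (dt g a a' *: m).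
Proof.
move=> ag a'g; rewrite /= (ten3_scale_hom _ _ ag) ten3_ractE mulr1.
have b1 : ga_comp 1%g (cp_u A' g * a').
  by rewrite -(mulgV g); apply: ga_compM => //; exact: cp_u_comp.
rewrite t3_comp1 // scalerA dt_mul1l //; last exact: ga_comp1.
by rewrite mulrA cp_uVu !mul1r.
Qed.

Definition eta3 : {linear M -> gcomp1 (gb_tens_over_B' M)} :=
  to_gcomp1 (N := gb_tens_over_B' M) eta3_funD eta3_fun_comp eta3_fun_dt.

(** A retraction is [m (x) a' |-> (1 (x) a'_1) m], with [a'_1] the degree 1 component of [a']. *)
Lemma eta3_inj : injective eta3.
Proof.
pose r : tens_over_B' M -> M := tensor_lift (fun m (a' : A') => dt 1%g 1 a' *: m).
suff rE m : r (eta3_fun m) = m by move=> m n [/(congr1 r)]; rewrite !rE.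
rewrite /r tensor_liftE; first by rewrite dt1 scale1r.
split=> [a' x y|n x y|n [b b1] a'].
- by rewrite scalerDr.
- by rewrite dtDr scalerDl.
by rewrite scalerA dt_mul1r ?mulr1 //; exact: ga_comp1.
Qed.

Lemma eta3_surj v : exists m, eta3 m = v.
Proof.
suff [m em] : exists m, eta3_fun m = val v by exists m; apply: val_inj.
move: (val v) (gcomp1P v); apply: addspan_ind.
- by exists 0; exact: addmap0 eta3_funD.
- by move=> _ _ [m <-] [n <-]; exists (m + n); exact: eta3_funD.
move=> _ [m [b [b1 ->]]]; exists (dt 1%g 1 b *: m).
by rewrite -t3_comp1.
Qed.
End Unit.

Section Counit.
Variable N : graded_bimodule A A'.

Definition eps3_fun : tens_over_B' (gcomp1 N) -> N :=
  tensor_lift (fun n (a' : A') => gb_ract (val n) a').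

Lemma eps3_balanced : balanced
  (fun (n : gcomp1 N) (b' : comp1_of A') => dt 1%g 1 (sval b') *: n)
  (fun (b' : comp1_of A') (a' : A') => sval b' * a')
  (fun n (a' : A') => gb_ract (val n) a').
Proof.
split=> [a' x y|n x y|n [b b1] a'].
- exact: gb_ractDl.
- exact: gb_ractDr.
by rewrite val_dt_scale ?invg1 //; [rewrite scale1r gb_ractM|exact: ga_comp1].
Qed.

Lemma eps3_funE n a' : eps3_fun (t3 n a') = gb_ract (val n) a'.
Proof. exact: tensor_liftE eps3_balanced _ _. Qed.
Lemma eps3_funD : addmap eps3_fun.
Proof. exact: tensor_liftD eps3_balanced. Qed.

(** Here it is the left action that involves the units: for [x] of degree [g],
    [(x n u'_g^-1) (u'_g a') = x n a']. *)
Lemma eps3_funZ : scalable eps3_fun.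
Proof.
move=> x v; elim/ten3_ind: v => [|v w ev ew|n a'].
- by rewrite scaler0 (addmap0 eps3_funD) scaler0.
- by rewrite scalerDr !eps3_funD ev ew scalerDr.
apply: (hom_ext (@ga_grading _ _ A) (f := fun x => eps3_fun (x *: t3 n a'))
  (g := fun x => x *: eps3_fun (t3 n a'))).
- by move=> y z; rewrite scalerDl eps3_funD.
- by move=> y z; rewrite scalerDl.
move=> g {}x xg; rewrite (ten3_scale_hom _ _ xg) !eps3_funE val_dt_scale //.
  by rewrite -gb_ractM mulrA cp_uVu mul1r gb_ractZ.
exact: cp_uV_comp.
Qed.

Lemma eps3_fun_ract v y : eps3_fun (ten3_ract v y) = gb_ract (eps3_fun v) y.
Proof.
elim/ten3_ind: v => [|v w ev ew|n a'].
- by rewrite (addmap0 (ten3_ractD _)) (addmap0 eps3_funD) (addmap0 (gb_ractDl _)).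
- by rewrite ten3_ractD !eps3_funD ev ew gb_ractDl.
by rewrite ten3_ractE !eps3_funE gb_ractM.
Qed.

Lemma eps3_fun_comp x v : ten3_comp x v -> gb_comp x (eps3_fun v).
Proof.
have sg := (gb_grading N).1 x.
move: v; apply: addspan_ind => [|v w ev ew|_ [n [a [ax ->]]]].
- by rewrite (addmap0 eps3_funD); exact: subgroup0 sg.
- by rewrite eps3_funD; exact: subgroupD sg ev ew.
rewrite [X in gb_comp x X]eps3_funE -(scale1r (val n)) -[x]mul1g -(mulg1 1%g).
by apply: gb_compM => //; [exact: ga_comp1|exact: gcomp1P].
Qed.

Definition eps3 : gb_hom (gb_tens_over_B' (gcomp1 N)) N :=
  @GbHom _ _ _ _ _ (gb_tens_over_B' (gcomp1 N)) N (mk_linear eps3_funD eps3_funZ)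
    eps3_fun_ract eps3_fun_comp.
End Counit.

Lemma tens_over_B'_inverse :
  inverse_equivalences (tens_over_B'_functor A A') (component1_functor A A').
Proof.
apply: (@inverse_equivalences_comp1 (tens_over_B'_functor A A') eta3 eps3).
- exact: eta3_inj.
- exact: eta3_surj.
- by move=> M M' f m; exact: ten3_homE.
- move=> N N' f; apply: tensor_ext => [x y|x y|n a'].
  + by rewrite /= ten3_homD eps3_funD.
  + by rewrite /= eps3_funD linearD.
  by rewrite /= [ten3_hom _ _]ten3_homE [LHS]eps3_funE [eps3_fun _]eps3_funE gb_fun_ract.
by move=> N n; rewrite /= [LHS]eps3_funE gb_ract1.
Qed.
End TensorOverB'.

End OneComponent.

Theorem proposition2p11 (O : idomainType) (O_cdvr : complete_dvr O)
    (gT : finGroupType) (N : {group gT}) (N_normal : (N <| [set: gT])%g)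
    (C : graded_acted_algebra O (coset_of N))
    (A A' : crossed_product_over C) :
  let F1 := tens_over_diag_functor A A' in
  let F2 := tens_over_B_functor A A' in
  let F3 := tens_over_B'_functor A A' in
  let G := component1_functor A A' in
  [/\ nat_isomorphic F1 F2, nat_isomorphic F2 F3 & nat_isomorphic F1 F3] /\
  [/\ is_equivalence F1, is_equivalence F2 & is_equivalence F3] /\
  [/\ inverse_equivalences F1 G, inverse_equivalences F2 G
    & inverse_equivalences F3 G].
Proof.
have e1 := tens_over_diag_inverse A A'.
have e2 := tens_over_B_inverse A A'.
have e3 := tens_over_B'_inverse A A'.
split; first split.
- exact: inverse_equivalences_uniq e1 e2.
- exact: inverse_equivalences_uniq e2 e3.
- exact: inverse_equivalences_uniq e1 e3.
by split; split=> //; exists (component1_functor A A').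
Qed.
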